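(* Let $m\ge n\ge 1$, let $-\infty<a<b<\infty$ and $-\infty<c<d<\infty$ with either $b<c$ or $d<a$, let $x_1<\cdots<x_m$ be points in $[a,b]$ and $y_1<\cdots<y_n$ points in $[c,d]$, let $\underline{s}\in\mathbb{C}^{m}$, $\underline{t}\in\mathbb{C}^{n}$, and let $C_{m,n}$ be the $m\times n$ (generalized) Cauchy matrix with entries $(C_{m,n})_{jk}=\frac{s_jt_k}{x_j-y_k}$, $1\le j\le m$, $1\le k\le n$. Let $\gamma=\frac{|c-a|\,|d-b|}{|c-b|\,|d-a|}$ be the absolute value of the cross-ratio of $a,b,c,d$. Then, for every $0<\epsilon<1$, \[ \mathrm{rank}_\epsilon(C_{m,n})\le\left\lceil\frac{2\mu(1/\sqrt{\gamma})\,\log(4/\epsilon)}{\pi^2}\right\rceil\le\left\lceil\frac{\log(16\gamma)\,\log(4/\epsilon)}{\pi^2}\right\rceil, \] where $\mu$ is the Gr\''otzsch ring function.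
   Context: $\sigma_1(X)\ge\cdots\ge\sigma_n(X)\ge 0$ denote the singular values of an $m\times n$ matrix $X$ with $m\ge n$, with the convention $\sigma_{n+1}(X)=0$, and $\|X\|_2=\sigma_1(X)$. For $0<\epsilon<1$, the $\epsilon$-rank is $\mathrm{rank}_\epsilon(X)=\min\{k\ge 0:\sigma_{k+1}(X)\le\epsilon\|X\|_2\}$. The Gr\''otzsch ring function is $\mu(\lambda)=\frac{\pi}{2}\,K(\sqrt{1-\lambda^2})/K(\lambda)$ for $0<\lambda<1$, where $K(\lambda)=\int_0^1 \frac{dt}{\sqrt{(1-t^2)(1-\lambda^2t^2)}}$ is the complete elliptic integral of the first kind. *)

(* Defs.v *)
From mathcomp Require Import all_boot all_order all_algebra.
From mathcomp Require Import complex.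
From mathcomp Require Import all_classical all_reals all_analysis.

Set Implicit Arguments.
Unset Strict Implicit.
Unset Printing Implicit Defensive.

Import Order.TTheory GRing.Theory Num.Theory.

Local Open Scope ring_scope.
Local Open Scope complex_scope.
Local Open Scope sesquilinear_scope.

(* The n singular values of X, in nonincreasing order: the square roots of the
   eigenvalues, counted with multiplicity, of the positive semidefinite
   Hermitian matrix X^* X.  [spectral_diag] lists these eigenvalues in an
   unspecified order, as complex numbers with zero imaginary part. *)
Definition singular_values (R : realType) (m n : nat) (X : 'M[R[i]]_(m, n)) :
    seq R :=
  sort >=%R
    [seq Num.sqrt (complex.Re (spectral_diag (X^t* *m X) 0 i)) | i : 'I_n].

(* Indices start at 1 and sigma X k = 0 for k > n; sigma X 0 is a junk value. *)
Definition sigma (R : realType) (m n : nat) (X : 'M[R[i]]_(m, n)) (k : nat) : R :=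
  nth 0 (singular_values X) k.-1.

(* The least k in {0, ..., n} with sigma_{k+1}(X) <= eps * ||X||_2, where
   ||X||_2 = sigma_1(X).  For eps >= 0, k = n always qualifies because
   sigma_{n+1}(X) = 0, so the value of the minimum is never the default. *)
Definition eps_rank (R : realType) (m n : nat) (eps : R) (X : 'M[R[i]]_(m, n)) :
    nat :=
  [arg min_(k < (ord_max : 'I_n.+1) | sigma X k.+1 <= eps * sigma X 1) (k : nat)].

(* Lebesgue integral; at the endpoint t = 1 the integrand is 0 since 0^-1 = 0. *)
Definition ellipticK (R : realType) (l : R) : R :=
  \int[lebesgue_measure]_(t in `[0%R, 1%R]%classic)
    (Num.sqrt ((1 - t ^+ 2) * (1 - l ^+ 2 * t ^+ 2)))^-1.

Definition grotzsch_mu (R : realType) (l : R) : R :=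
  pi / 2 * (ellipticK (Num.sqrt (1 - l ^+ 2)) / ellipticK l).

Definition cauchy_mx (R : realType) (m n : nat) (x : 'I_m -> R) (y : 'I_n -> R)
    (s : 'cV[R[i]]_m) (t : 'cV[R[i]]_n) : 'M[R[i]]_(m, n) :=
  \matrix_(j, k) (s j 0 * t k 0 / (x j - y k)%:C).

Definition abs_cross_ratio (R : realType) (a b c d : R) : R :=
  `|c - a| * `|d - b| / (`|c - b| * `|d - a|).

(* Main.v *)
Require Import Defs.
From mathcomp Require Import all_boot all_order all_algebra.
From mathcomp Require Import complex.
From mathcomp Require Import all_classical all_reals all_analysis.
From mathcomp Require Import measurable_realfun.
From mathcomp Require Import ring lra zify.

Set Implicit Arguments.
Unset Strict Implicit.
Unset Printing Implicit Defensive.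

Import Order.TTheory GRing.Theory Num.Theory.
Import numFieldNormedType.Exports.

Local Open Scope ring_scope.
Local Open Scope complex_scope.
Local Open Scope sesquilinear_scope.

(** The proof produces, for every [k >= 1], a rational function of degree k that
    separates [[a, b]] from [[c, d]] with the optimal constant, and feeds it to
    the displacement structure of Cauchy matrices.

    Linear algebra. Suppose that polynomials P and Q of degree at most k satisfy
    [|P| <= rho |Q|] at the nodes x and [|Q| <= rho |P|] at the nodes y. The
    Bezoutian of P and Q shows that the Cauchy matrix C agrees with
    [(P/Q)(A) C (Q/P)(B)] up to a matrix of rank at most k, where A and B are the
    diagonal matrices of the nodes. The singular value of index [k + 1] is therefore at
    most [rho ^ 2] times the first one ([sigma_cauchy_le]). It remains to reach
    [rho <= 2 p ^ k] with [4 p ^ (2 k) <= eps].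

    Rational functions. Write [theta p x] for the sum of [p ^ (n ^ 2) cos (n x)]
    over all integers n, and [dnq p x = theta p x / theta p (x + pi)]. The function
    [dnq p] maps the real line onto an interval [[1 / L, L]]. Two formulas for
    theta carry the argument. The bilinear identity [theta_bilinear], a rotation by 45
    degrees of the lattice of exponents, shows that [theta p (x + a) theta p (x - a)]
    is a combination of [theta p x ^ 2] and [theta p (x + pi) ^ 2]. Jacobi's triple
    product, [triple_product], allows the factors to be grouped along the k-th
    roots of unity. Together they say that [dnq (p ^ k) (k x)] is an odd rational
    function s of degree k of [dnq p x] ([dnq_transform]). Since [dnq (p ^ k)]
    is within a factor [1 + O(p ^ k)] of 1, s approximates the sign function on
    [[1 / L, L]] and its opposite, and [(s - 1) / (s + 1)] is a Zolotarev function
    with [rho = 2 p ^ k] ([zolotarev_ratio]). A Moebius map carries the two given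
    intervals into [[1 / L, L]] and its opposite as soon as
    [om <= (L ^ 2 - 1) / (L ^ 2 + 1)], where [om = sqrt (1 - 1 / gamma)]
    ([zolotarev_intervals]).

    Nome and modulus. It remains to see that [p = exp (- mu om)] is large enough
    for this ([modq_nome]); then [p ^ (2 k) = exp (- 2 k mu om)] is what the theorem
    needs, because [mu lam * mu om = pi ^ 2 / 4] for [lam = 1 / sqrt gamma].
    Both sides obey Landen's transformation: mu is doubled ([grotzsch_mu_landen],
    from Gauss's change of variable in the elliptic integral) and the nome is squared
    ([landen_modq], from the bilinear identity). Iterating the transformation
    reduces every comparison to small moduli, where crude bounds on the elliptic
    integral and on theta suffice, since any bounded factor is lost in the limit. The
    same iteration proves [mu l <= ln (4 / l)] ([grotzsch_mu_le]), which is the second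
    inequality of the theorem. *)

(** * Singular values of a Cauchy matrix *)

Definition sqnorm (C : numClosedFieldType) n (v : 'cV[C]_n) : C :=
  \sum_i `|v i 0| ^+ 2.

Lemma sqnorm_ge0 (C : numClosedFieldType) n (v : 'cV[C]_n) : 0 <= sqnorm v.
Proof. by apply: sumr_ge0 => i _; rewrite exprn_ge0. Qed.

Lemma sqnorm_gt0 (C : numClosedFieldType) n (v : 'cV[C]_n) :
  v != 0 -> 0 < sqnorm v.
Proof.
move=> v0; rewrite lt_def sqnorm_ge0 andbT; apply: contra v0 => /eqP.
move=> /psumr_eq0P H; apply/eqP/matrixP => i j; rewrite ord1 mxE.
have /eqP := H (fun i _ => exprn_ge0 _ (normr_ge0 _)) i isT.
by rewrite sqrf_eq0 normr_eq0 => /eqP.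
Qed.

Lemma sqnormE (C : numClosedFieldType) n (v : 'cV[C]_n) :
  sqnorm v = (v^t* *m v) 0 0.
Proof.
by rewrite mxE; apply: eq_bigr => i _; rewrite !mxE normCK mulrC.
Qed.

Lemma sqnorm_unitary (C : numClosedFieldType) n (U : 'M[C]_n) (v : 'cV[C]_n) :
  U \is unitarymx -> sqnorm (U *m v) = sqnorm v.
Proof.
move=> Uu; rewrite !sqnormE trmx_mul map_mxM mulmxA -(mulmxA _ _ U).
by rewrite -(invmx_unitary Uu) mulVmx ?unitarymx_unit// mulmx1.
Qed.

Section gram.
Variables (R : realType) (m n : nat) (X : 'M[R[i]]_(m, n)).
Let G : 'M[R[i]]_n := X^t* *m X.
Let U := spectralmx G.
Let d := spectral_diag G.

Lemma gram_hermitian : G \is hermsymmx.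
Proof.
rewrite is_hermitianmxE expr0 scale1r /G trmx_mul map_mxM.
by rewrite trmxCK.
Qed.

Lemma sqnorm_gram (v : 'cV[R[i]]_n) :
  sqnorm (X *m v) = \sum_i d 0 i * `|(U *m v) i 0| ^+ 2.
Proof.
have /orthomx_spectralP GE := hermitian_normalmx gram_hermitian.
rewrite sqnormE trmx_mul map_mxM mulmxA -(mulmxA _ _ X) -/G GE.
rewrite invmx_unitary ?spectral_unitarymx// !mulmxA -map_mxM -trmx_mul.
rewrite -!mulmxA -/U mulmxA mxE; apply: eq_bigr => i _.
by move: (U *m v) => w; rewrite mul_mx_diag !mxE normCK; ring.
Qed.

Lemma gram_spectrum_ge0 i : 0 <= d 0 i.
Proof.
have Uu : U \is unitarymx by exact: spectral_unitarymx.
pose v : 'cV_n := U^t* *m delta_mx i 0.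
have Uv : U *m v = delta_mx i 0 by rewrite mulmxA (unitarymxP Uu) mul1mx.
have := sqnorm_ge0 (X *m v); rewrite sqnorm_gram Uv (bigD1 i)//= big1.
  by rewrite addr0 !mxE !eqxx normr1 expr1n mulr1.
by move=> j ji; rewrite !mxE (negbTE ji) normr0 expr0n mulr0.
Qed.

Let s i : R := Num.sqrt (complex.Re (d 0 i)).

Lemma gram_spectrumE i : d 0 i = (s i ^+ 2)%:C.
Proof.
have := gram_spectrum_ge0 i; rewrite /s; case: (d 0 i) => x y.
rewrite lecE /= => /andP[/eqP -> x0].
by rewrite sqr_sqrtr.
Qed.

Lemma singular_valuesE : singular_values X = sort >=%R [seq s i | i <- enum 'I_n].
Proof. by []. Qed.

Lemma le_sigma1 i : s i <= sigma X 1.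
Proof.
have n0 : (0 < n)%N by case: i => i; case: (n).
rewrite /sigma /= singular_valuesE.
set l := map _ _; have : s i \in sort >=%R l.
  by rewrite mem_sort; apply: map_f; rewrite mem_enum.
have := sort_sorted (@ge_total _ R) l; case: sort => //= a r.
move=> /(order_path_min (fun a b c H1 H2 => ge_trans H1 H2))/allP H.
by rewrite inE => /orP[/eqP ->//|/H].
Qed.

Lemma sigma_top k : (k < n)%N ->
  {f : 'I_k.+1 -> 'I_n | injective f & forall i, sigma X k.+1 <= s (f i)}.
Proof.
move=> kn; rewrite /sigma /= singular_valuesE.
have i0 : 'I_n by exact: (Ordinal kn).
rewrite sort_map; set l := sort _ _.
have sl : size l = n by rewrite size_sort size_enum_ord.
have ul : uniq l by rewrite sort_uniq enum_uniq.
exists (fun i : 'I_k.+1 => nth i0 l i) => [i j /eqP|i].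
  rewrite nth_uniq ?sl//; first by move=> /eqP/val_inj.
  - by apply: leq_trans kn; case: i.
  - by apply: leq_trans kn; case: j.
rewrite (nth_map i0) ?sl// -/(s _).
have tr : transitive (relpre s >=%R).
  by move=> a b c H1 H2; exact: ge_trans H1 H2.
have so : sorted (relpre s >=%R) l.
  by apply: sort_sorted => a b; exact: ge_total.
have := sorted_leq_nth tr (fun a => lexx (s a)) i0 so.
move=> /(_ (nat_of_ord i) k); rewrite !inE sl; apply => //.
  by apply: leq_trans kn; case: i.
by rewrite -ltnS; case: i.
Qed.

Lemma sigma1_ge0 : 0 <= sigma X 1.
Proof.
rewrite /sigma; have [/(nth_default _) -> //|H] := leqP (size (singular_values X)) 0.
have := mem_nth 0 H; rewrite singular_valuesE mem_sort => /mapP[i _ ->].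
exact: sqrtr_ge0.
Qed.

Lemma sqnorm_mulmx_le (v : 'cV[R[i]]_n) :
  sqnorm (X *m v) <= (sigma X 1 ^+ 2)%:C * sqnorm v.
Proof.
rewrite sqnorm_gram -(sqnorm_unitary v (spectral_unitarymx G)) mulr_sumr.
apply: ler_sum => i _; rewrite gram_spectrumE ler_wpM2r ?exprn_ge0//.
by rewrite lecR ler_sqr ?nnegrE ?sqrtr_ge0 ?sigma1_ge0// le_sigma1.
Qed.

(** Half of the Courant-Fischer principle: k linear conditions cannot exclude
    every vector of the span of the k+1 leading right singular vectors. *)
Lemma sigma_le_on_kernel k (M : 'M[R[i]]_(k, n)) (c : R) : 0 <= c ->
  (forall v, M *m v = 0 -> sqnorm (X *m v) <= (c ^+ 2)%:C * sqnorm v) ->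
  sigma X k.+1 <= c.
Proof.
move=> c0 H; have [nk|kn] := leqP n k.
  by rewrite /sigma /= nth_default// singular_valuesE size_sort size_map size_enum_ord.
have [f fi fs] := sigma_top kn.
have Uu : U \is unitarymx by exact: spectral_unitarymx.
pose B : 'M[R[i]]_(n, k.+1) := \matrix_(i, j) (i == f j)%:R.
pose A := M *m U^t* *m B.
have [z zA z0] : exists2 z : 'cV[R[i]]_k.+1, A *m z = 0 & z != 0.
  (* k equations in k + 1 unknowns *)
  have : kermx A^T != 0.
    rewrite -mxrank_eq0 mxrank_ker subn_eq0 -ltnNge ltnS.
    by rewrite mxrank_tr rank_leq_row.
  move=> /rowV0Pn[w /sub_kermxP wA w0].
  exists w^T; last by rewrite trmx_eq0.
  by apply: trmx_inj; rewrite trmx_mul trmxK wA trmx0.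
pose v : 'cV_n := U^t* *m (B *m z).
have Uv : U *m v = B *m z by rewrite mulmxA (unitarymxP Uu) mul1mx.
have Bf j : (B *m z) (f j) 0 = z j 0.
  rewrite mxE (bigD1 j)//= big1 ?addr0 ?mxE ?eqxx ?mul1r// => l lj.
  by rewrite mxE (inj_eq fi) eq_sym (negbTE lj) mul0r.
have Bn i : (forall j, i != f j) -> (B *m z) i 0 = 0.
  by move=> nf; rewrite mxE big1// => l _; rewrite mxE (negbTE (nf l)) mul0r.
have v0 : 0 < sqnorm v.
  rewrite -(sqnorm_unitary v Uu) Uv; apply: sqnorm_gt0.
  apply: contra z0 => /eqP Bz; apply/eqP/matrixP => j l.
  by rewrite ord1 -Bf Bz !mxE.
have Mv : M *m v = 0 by rewrite -zA /A !mulmxA.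
have [//|cs] := leP (sigma X k.+1) c.
suff : (c ^+ 2)%:C * sqnorm v < sqnorm (X *m v).
  by move=> /lt_le_trans /(_ (H v Mv)); rewrite ltxx.
apply: (@lt_le_trans _ _ ((sigma X k.+1 ^+ 2)%:C * sqnorm v)).
  rewrite ltr_pM2r// ltcR ltr_sqr ?nnegrE//.
  exact: le_trans (ltW cs).
rewrite sqnorm_gram -(sqnorm_unitary v Uu) mulr_sumr.
apply: ler_sum => i _; rewrite Uv.
have [j /eqP ->|nf] := pickP (fun j => i == f j); last first.
  by rewrite Bn ?normr0 ?expr0n ?mulr0// => j; rewrite nf.
rewrite gram_spectrumE ler_wpM2r ?exprn_ge0// lecR ler_sqr ?nnegrE ?sqrtr_ge0//.
exact: le_trans (ltW cs).
Qed.

End gram.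

Lemma sqnorm_diag_le (R : realType) n (g : 'rV[R[i]]_n) (rho : R)
    (v : 'cV[R[i]]_n) :
  0 <= rho -> (forall i, `|g 0 i| <= rho%:C) ->
  sqnorm (diag_mx g *m v) <= (rho ^+ 2)%:C * sqnorm v.
Proof.
move=> r0 gr; rewrite mulr_sumr; apply: ler_sum => i _.
rewrite mul_diag_mx mxE normrM exprMn ler_wpM2r ?exprn_ge0//.
rewrite rmorphXn /= lerXn2r ?nnegrE// ?gr//.
by rewrite lecR.
Qed.

Section bezout.
Variables (R : comNzRingType).

(** The coefficient of [x ^ i] in [(P(x) - P(y)) / (x - y)], for P of degree at
    most k. *)
Definition divided_diff (P : {poly R}) (k i : nat) (y : R) : R :=
  \sum_(j < k.+1 | (i < j)%N) P`_j * y ^+ (j - i.+1).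

Lemma divided_diffP (P : {poly R}) k (x y : R) : (size P <= k.+1)%N ->
  P.[x] - P.[y] = (x - y) * \sum_(i < k) x ^+ i * divided_diff P k i y.
Proof.
move=> sP; rewrite !(horner_coef_wide _ sP) -sumrB mulr_sumr.
transitivity (\sum_(i < k) \sum_(j < k.+1 | (i < j)%N)
   (x - y) * (x ^+ i * (P`_j * y ^+ (j - i.+1)))); last first.
  by apply: eq_bigr => i _; rewrite /divided_diff !mulr_sumr.
rewrite (exchange_big_dep xpredT)//=; apply: eq_bigr => j _.
rewrite -mulrBr subrXX mulrCA [in RHS]big_mkcond/=.
rewrite -(big_mkord xpredT (fun i => if (i < j)%N then
   (x - y) * (x ^+ i * (P`_j * y ^+ (j - i.+1))) else 0)).
rewrite (@big_cat_nat _ _ _ j)//=; last by case: j.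
rewrite [X in _ = _ + X]big_nat [X in _ = _ + X]big1 ?addr0; last first.
  by move=> i /andP[ji _]; rewrite ltnNge ji.
rewrite -(big_mkord xpredT (fun i => x ^+ (j.-1 - i) * y ^+ i)) big_nat_rev.
rewrite !mulr_sumr [LHS]big_nat [RHS]big_nat; apply: eq_bigr => i /= ij.
rewrite ij.
have -> : (j.-1 - (0 + j - i.+1) = i)%N by lia.
have -> : (0 + j - i.+1 = j - i.+1)%N by lia.
ring.
Qed.
End bezout.

Lemma diag_conj_mxE (R : comNzRingType) m n (g : 'rV[R]_m) (A : 'M[R]_(m, n))
    (h : 'rV[R]_n) j l :
  (diag_mx g *m A *m diag_mx h) j l = g 0 j * A j l * h 0 l.
Proof. by rewrite mul_mx_diag mxE mul_diag_mx mxE. Qed.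

Section cauchy_sigma.
Variables (R : realType) (m n : nat) (x : 'I_m -> R) (y : 'I_n -> R).
Variables (s : 'cV[R[i]]_m) (t : 'cV[R[i]]_n).
Hypothesis xy : forall j l, x j != y l.

(** The displacement structure: with A and B the diagonal matrices of the
    nodes, [P(A) C Q(B) - Q(A) C P(B)] has rank at most k because the Bezoutian
    [(P(x) Q(y) - Q(x) P(y)) / (x - y)] is a polynomial of degree below k in x.
    On the kernel of this matrix C coincides with
    [P(A) Q(A)^-1 C Q(B) P(B)^-1], whose norm is at most [rho ^ 2] that of C. *)
Lemma sigma_cauchy_le k (P Q : {poly R}) (rho : R) :
  (size P <= k.+1)%N -> (size Q <= k.+1)%N -> 0 <= rho ->
  (forall j, Q.[x j] != 0 /\ `|P.[x j]| <= rho * `|Q.[x j]|) ->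
  (forall l, P.[y l] != 0 /\ `|Q.[y l]| <= rho * `|P.[y l]|) ->
  sigma (cauchy_mx x y s t) k.+1 <= rho ^+ 2 * sigma (cauchy_mx x y s t) 1.
Proof.
move=> sP sQ r0 Hx Hy; set C := cauchy_mx x y s t.
pose b i l : R := divided_diff P k i (y l) * Q.[y l] -
                  divided_diff Q k i (y l) * P.[y l].
pose M : 'M[R[i]]_(k, n) := \matrix_(i, l) (t l 0 * (b i l / P.[y l])%:C).
pose gx : 'rV[R[i]]_m := \row_j (P.[x j] / Q.[x j])%:C.
pose gy : 'rV[R[i]]_n := \row_l (Q.[y l] / P.[y l])%:C.
pose N : 'M[R[i]]_(m, k) := \matrix_(j, i) (s j 0 * (x j ^+ i / Q.[x j])%:C).
(* N and M are the two factors, of inner dimension k, of the displaced matrix,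
   both rescaled by the diagonal matrices that turn P and Q into quotients. *)
have key : C = diag_mx gx *m C *m diag_mx gy - N *m M.
  apply/matrixP => j l.
  have CE : C j l = s j 0 * t l 0 * ((x j - y l)^-1)%:C.
    by rewrite mxE fmorphV.
  have gxE : gx 0 j = (P.[x j] / Q.[x j])%:C by rewrite mxE.
  have gyE : gy 0 l = (Q.[y l] / P.[y l])%:C by rewrite mxE.
  rewrite [RHS]mxE diag_conj_mxE CE gxE gyE.
  have -> : (- (N *m M)) j l = - (\sum_i N j i * M i l).
    by rewrite mxE; congr (- _); rewrite mxE.
  under eq_bigr do rewrite !mxE.
  have [Qx _] := Hx j; have [Py _] := Hy l.
  have xy0 : x j - y l != 0 by rewrite subr_eq0.
  have -> : \sum_(i < k) s j 0 * (x j ^+ i / Q.[x j])%:C *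
                        (t l 0 * (b i l / P.[y l])%:C) =
    s j 0 * t l 0 * (\sum_(i < k) x j ^+ i * b i l / (Q.[x j] * P.[y l]))%:C.
    rewrite rmorph_sum mulr_sumr; apply: eq_bigr => i _ /=.
    rewrite mulrACA -rmorphM /=; congr (_ * _%:C).
    by field; rewrite Qx Py.
  have -> : \sum_(i < k) x j ^+ i * b i l / (Q.[x j] * P.[y l]) =
      (P.[x j] * Q.[y l] - Q.[x j] * P.[y l])
      / ((x j - y l) * Q.[x j] * P.[y l]).
    have -> : P.[x j] * Q.[y l] - Q.[x j] * P.[y l] =
       (P.[x j] - P.[y l]) * Q.[y l] - (Q.[x j] - Q.[y l]) * P.[y l] by ring.
    rewrite (divided_diffP _ _ sP) (divided_diffP _ _ sQ).
    rewrite -!(mulrA (x j - y l)) -mulrBr !mulr_suml -sumrB mulr_sumr mulr_suml.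
    by apply: eq_bigr => i _; rewrite /b; field; rewrite Qx Py.
  have pull (w : R[i]) (p q r e : R) :
      p%:C * (w * q%:C) * r%:C - w * e%:C = w * (p * q * r - e)%:C.
    by rewrite rmorphB !rmorphM /=; ring.
  rewrite pull; congr (_ * _%:C).
  by field; rewrite Qx Py.
apply: (sigma_le_on_kernel (M := M)) => [|v Mv].
  by rewrite mulr_ge0 ?exprn_ge0// sigma1_ge0.
have -> : C *m v = diag_mx gx *m (C *m (diag_mx gy *m v)).
  rewrite {1}key mulmxBl -[N *m M *m v]mulmxA Mv mulmx0 subr0.
  by rewrite !mulmxA.
have nrm (z w : R) : w != 0 -> `|z| <= rho * `|w| -> `|(z / w)%:C| <= rho%:C.
  move=> w0 zw; rewrite normc_def/= expr0n addr0 sqrtr_sqr lecR normf_div.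
  by rewrite ler_pdivrMr ?normr_gt0.
have rC : 0 <= (rho ^+ 2)%:C by rewrite lecR exprn_ge0.
apply: le_trans (sqnorm_diag_le _ r0 _) _.
  by move=> i; rewrite mxE; have [] := Hx i => *; exact: nrm.
rewrite exprMn -exprM (exprM _ 2 2) [(_ ^+ 2) ^+ 2]expr2.
have -> : (rho ^+ 2 * rho ^+ 2 * sigma C 1 ^+ 2)%:C * sqnorm v =
  (rho ^+ 2)%:C * ((sigma C 1 ^+ 2)%:C * ((rho ^+ 2)%:C * sqnorm v)).
  by rewrite !rmorphM /=; ring.
apply: ler_wpM2l => //.
apply: le_trans (sqnorm_mulmx_le _ _) _; apply: ler_wpM2l.
  by rewrite lecR exprn_ge0// sigma1_ge0.
apply: sqnorm_diag_le => // i; rewrite mxE; have [] := Hy i => *; exact: nrm.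
Qed.

End cauchy_sigma.

Lemma eps_rank_le (R : realType) m n (eps : R) (X : 'M[R[i]]_(m, n)) k :
  0 < eps -> sigma X k.+1 <= eps * sigma X 1 -> (eps_rank eps X <= k)%N.
Proof.
move=> e0 H; rewrite /eps_rank; have s1 := sigma1_ge0 X.
case: arg_minnP => [|i _ imin].
  have -> : sigma X (@ord_max n).+1 = 0.
    by rewrite /sigma nth_default// singular_valuesE size_sort size_map size_enum_ord.
  exact: mulr_ge0 (ltW e0) s1.
have [nk|kn] := leqP n k.
  by apply: leq_trans nk; rewrite -ltnS.
by have := imin (Ordinal (ltnW kn : (k < n.+1)%N)) H.
Qed.
(** * The complete elliptic integral *)

Section calculus.
Variable R : realType.
Implicit Types (F f : R -> R) (a b t : R).
Local Open Scope classical_set_scope.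

Lemma within_continuousP (A : set R) f :
  (forall t, A t -> {for t, continuous f}) -> {within A, continuous f}.
Proof.
move=> H; apply: continuous_in_subspaceT => t.
by rewrite inE => /H.
Qed.

Lemma is_derive_continuous f t (d : R) : is_derive t 1 f d -> {for t, continuous f}.
Proof.
by move=> H; apply/differentiable_continuous/derivable1_diffP; case: H.
Qed.

Lemma derivable_ooP F f a b : a <= b ->
  (forall t, a <= t <= b -> is_derive t 1 F (f t)) ->
  derivable_oo_LRcontinuous F a b /\ {in `]a, b[%R, F^`()%classic =1 f}.
Proof.
move=> ab H; split.
  split.
  - move=> t; rewrite in_itv /= => /andP[/ltW ? /ltW ?].
    have /H [//] : a <= t <= b by apply/andP.
  - apply/cvg_at_right_filter/(is_derive_continuous (H a _)).
    by rewrite lexx ab.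
  - apply/cvg_at_left_filter/(is_derive_continuous (H b _)).
    by rewrite lexx ab.
move=> t; rewrite in_itv /= => /andP[/ltW ? /ltW ?].
have /H [? e] : a <= t <= b by apply/andP.
by rewrite derive1E.
Qed.

Lemma FTC_is_derive F f a b : a < b ->
  (forall t, a <= t <= b -> is_derive t 1 F (f t)) ->
  {within `[a, b], continuous f} ->
  (\int[lebesgue_measure]_(t in `[a, b]) (f t)%:E = (F b - F a)%:E)%E.
Proof.
move=> ab H fc; have [H1 H2] := derivable_ooP (ltW ab) H.
by rewrite (continuous_FTC2 ab fc H1 H2) EFinB.
Qed.

Lemma substitution_is_derive F f (G : R -> R) a b : a < b ->
  (forall t, is_derive t 1 F (f t)) -> continuous f ->
  {in `[a, b]%R &, {homo F : x y / x < y}} ->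
  {within `[F a, F b], continuous G} ->
  (\int[lebesgue_measure]_(t in `[F a, F b]) (G t)%:E =
   \int[lebesgue_measure]_(t in `[a, b]) (G (F t) * f t)%:E)%E.
Proof.
move=> ab H fc mono Gc.
have Ff : F^`() = f by apply/funext => t; rewrite derive1E; case: (H t).
rewrite (@integration_by_substitution_increasing _ F G a b) ?(ltW ab) ?Ff//.
- by apply/cvg_ex; exists (f a); apply/cvg_at_right_filter; exact: fc.
- by apply/cvg_ex; exists (f b); apply/cvg_at_left_filter; exact: fc.
- by have [] := @derivable_ooP F f a b (ltW ab) (fun t _ => H t).
Qed.

End calculus.

Section elliptic.
Variable R : realType.
Implicit Types (k t c x : R).
Local Open Scope classical_set_scope.

Definition ellf k t : R := (Num.sqrt ((1 - t ^+ 2) * (1 - k ^+ 2 * t ^+ 2)))^-1.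

Lemma ellf_ge0 k t : 0 <= ellf k t.
Proof. by rewrite invr_ge0 sqrtr_ge0. Qed.

Lemma radicand_gt0 k t : 0 <= k < 1 -> 0 <= t < 1 ->
  0 < (1 - t ^+ 2) * (1 - k ^+ 2 * t ^+ 2).
Proof.
move=> /andP[k0 k1] /andP[t0 t1]; have t2 : t ^+ 2 < 1 by nra.
have k2 : k ^+ 2 <= 1 by nra.
by apply: mulr_gt0; nra.
Qed.

Lemma ellf_continuous k t : 0 <= k < 1 -> 0 <= t < 1 ->
  {for t, continuous (ellf k)}.
Proof.
move=> k01 t01; have r0 := radicand_gt0 k01 t01.
apply: (@continuousV _ _ (fun t => Num.sqrt ((1 - t ^+ 2) * (1 - k ^+ 2 * t ^+ 2)))).
  by rewrite gt_eqF// sqrtr_gt0.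
apply: continuous_comp; last exact: sqrt_continuous.
apply: continuousM; apply: continuousB; try exact: cst_continuous.
  exact: exprn_continuous.
apply: continuousM; first exact: cst_continuous.
exact: exprn_continuous.
Qed.

Lemma ellf_within k c : 0 <= k < 1 -> c < 1 ->
  {within `[0, c], continuous (ellf k)}.
Proof.
move=> k01 c1; apply: within_continuousP => t /=.
rewrite in_itv /= => /andP[t0 tc]; apply: ellf_continuous => //.
by rewrite t0 (le_lt_trans tc).
Qed.

Lemma ellf_measurable k : 0 <= k < 1 -> measurable_fun `[0%R, (1:R)%R[ (EFin \o ellf k).
Proof.
move=> k01; apply/measurable_EFinP.
apply: subspace_continuous_measurable_fun; first exact: measurable_itv.
apply: within_continuousP => t /=; rewrite in_itv /=.
exact: ellf_continuous.
Qed.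

Definition ellI k c : \bar R := (\int[lebesgue_measure]_(t in `[0%R, c]) (ellf k t)%:E)%E.

Lemma ellI_sub c : c < 1 -> `[0%R, c] `<=` `[0%R, 1%R[.
Proof.
move=> c1 t /=; rewrite !in_itv /= => /andP[-> tc].
exact: le_lt_trans tc c1.
Qed.

Lemma ellI1E k : 0 <= k < 1 ->
  ellI k 1 = (\int[lebesgue_measure]_(t in `[0%R, 1%R[) (ellf k t)%:E)%E.
Proof. by move=> k01; rewrite /ellI -integral_itv_bndo_bndc//; exact: ellf_measurable. Qed.

Lemma ellI_le1 k c : 0 <= k < 1 -> c < 1 -> (ellI k c <= ellI k 1)%E.
Proof.
move=> k01 c1; rewrite (ellI1E k01); apply: ge0_subset_integral => //.
- exact: ellf_measurable.
- by move=> t _; rewrite lee_fin ellf_ge0.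
- exact: ellI_sub.
Qed.

Lemma ellI1_le k (M : \bar R) : 0 <= k < 1 ->
  (forall c, 0 < c < 1 -> (ellI k c <= M)%E) -> (ellI k 1 <= M)%E.
Proof.
move=> k01 H; rewrite (ellI1E k01).
(* The integrand is singular at 1: exhaust [0, 1) by compact intervals. *)
pose A (n : nat) : set R := `[0, 1 - n.+2%:R^-1].
have A1 n : 0 < 1 - (n.+2%:R^-1 : R) < 1.
  by rewrite subr_gt0 invf_lt1 ?ltr0n// ltr1n/= ltrBlDr ltrDl invr_gt0 ltr0n.
have UA : \bigcup_n A n = `[0, 1[.
  apply/seteqP; split=> [t [n _]|t /=].
    by apply: ellI_sub => //; have /andP[] := A1 n.
  rewrite in_itv /= => /andP[t0 t1].
  have [n Hn] : exists n, (1 - t)^-1 < n%:R.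
    exists (Num.truncn (1 - t)^-1).+1.
    by rewrite truncnS_gt.
  exists n => //; rewrite /A /= in_itv /= t0 /= lerBrDr -lerBrDl.
  rewrite invf_ple ?posrE ?ltr0n ?subr_gt0//.
  by apply: le_trans (ltW Hn) _; rewrite ler_nat; lia.
have mA n : measurable_fun (A n) (EFin \o ellf k).
  apply: (measurable_funS _ _ (ellf_measurable k01)) => //.
  by apply: ellI_sub => //; have /andP[] := A1 n.
have cv : (\int[lebesgue_measure]_(x in A i) (ellf k x)%:E)%E @[i --> \oo] -->
   (\int[lebesgue_measure]_(x in `[0%R, 1%R[) (ellf k x)%:E)%E.
  rewrite -UA; apply: ge0_nondecreasing_set_cvg_integral.
  - move=> n m nm; apply/subsetPset => t; rewrite /A /= !in_itv /= => /andP[-> tn] /=.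
    apply: le_trans tn _; rewrite lerD2l lerN2 lef_pV2 ?posrE ?ltr0n// ler_nat.
    by lia.
  - by move=> n; exact: measurable_itv.
  - exact: mA.
  - by move=> n t _; rewrite lee_fin ellf_ge0.
rewrite -(cvg_lim _ cv)//; apply: lime_le.
  by apply/cvg_ex; exists (\int[lebesgue_measure]_(x in `[0%R, 1%R[) (ellf k x)%:E)%E.
by apply: nearW => n; exact: H.
Qed.

Lemma is_derive_rat x t : 0 < 1 + x * t ^+ 2 ->
  is_derive t 1 (fun t => (1 + x) * t / (1 + x * t ^+ 2))
    ((1 + x) * (1 - x * t ^+ 2) / (1 + x * t ^+ 2) ^+ 2).
Proof.
move=> d0; have dn : 1 + x * t ^+ 2 != 0 by rewrite gt_eqF.
have Dd : is_derive t 1 (fun t : R => 1 + x * t ^+ 2) (x * (2 * t)).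
  apply: is_derive_eq; rewrite /GRing.scale /=; ring.
have Dv := is_deriveV (f := fun t : R => 1 + x * t ^+ 2) dn Dd.
have Dn : is_derive t 1 (fun t : R => (1 + x) * t) (1 + x).
  apply: is_derive_eq; rewrite /GRing.scale /=; ring.
apply: (is_derive_eq (is_deriveM Dn Dv)).
by rewrite /GRing.scale /=; field.
Qed.

Lemma gauss_map_lt1 x c : 0 < x < 1 -> 0 < c < 1 ->
  (1 + x) * c / (1 + x * c ^+ 2) < 1.
Proof.
move=> /andP[x0 x1] /andP[c0 c1]; have xc : x * c < 1 by nra.
rewrite ltr_pdivrMr ?mul1r; last by nra.
have : 0 < (1 - c) * (1 - x * c) by rewrite mulr_gt0; lra.
lra.
Qed.

(** Landen's transformation in the form given by Gauss: the substitution
    [s = (1 + x) t / (1 + x t ^ 2)] maps [0, 1] onto itself and carries the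
    differential with modulus k to [1 + x] times the one with modulus x. *)
Lemma ellI_landen k x c : 0 < x < 1 -> 0 <= k < 1 -> 0 < c < 1 ->
  k ^+ 2 * (1 + x) ^+ 2 = 4 * x ->
  (ellI k ((1 + x) * c / (1 + x * c ^+ 2)) = (1 + x)%:E * ellI x c)%E.
Proof.
move=> /andP[x0 x1] k01 /andP[c0 c1] kx.
pose S t : R := (1 + x) * t / (1 + x * t ^+ 2).
have den t : 0 < 1 + x * t ^+ 2 by nra.
have Slt t u : 0 <= t -> t < u -> u <= 1 -> S t < S u.
  move=> t0 tu u1; rewrite /S ltr_pdivrMr// mulrAC ltr_pdivlMr//.
  rewrite -subr_gt0.
  have -> : (1 + x) * u * (1 + x * t ^+ 2) - (1 + x) * t * (1 + x * u ^+ 2) =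
    (1 + x) * (u - t) * (1 - x * t * u) by ring.
  have tu1 : x * t * u < 1 by have := mulr_ge0 t0 (le_trans t0 (ltW tu)); nra.
  by apply: mulr_gt0; [apply: mulr_gt0|]; lra.
have S0 : S 0 = 0 by rewrite /S mulr0 mul0r.
have S1 : S 1 = 1 by rewrite /S; field; lra.
have Sc : S c < 1 by rewrite -S1; apply: Slt; lra.
pose s t := (1 + x) * (1 - x * t ^+ 2) / (1 + x * t ^+ 2) ^+ 2.
have dS t : is_derive t 1 S (s t) by exact: is_derive_rat.
have sc (t : R) : {for t, continuous s}.
  apply: continuousM.
    apply: continuousM; first exact: cst_continuous.
    apply: continuousB; first exact: cst_continuous.
    by apply: continuousM; [exact: cst_continuous|exact: exprn_continuous].
  apply: (@continuousV _ _ (fun t : R => (1 + x * t ^+ 2) ^+ 2)).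
    by rewrite expf_neq0// gt_eqF.
  apply: (@continuous_comp _ _ _ (fun t : R => 1 + x * t ^+ 2) (fun u => u ^+ 2)).
    apply: continuousD; first exact: cst_continuous.
    by apply: continuousM; [exact: cst_continuous|exact: exprn_continuous].
  exact: exprn_continuous.
have Smono : {in `[0, c]%R &, {homo S : t u / t < u}}.
  move=> t u; rewrite !in_itv /= => /andP[t0 _] /andP[_ u1] tu.
  by apply: Slt => //; lra.
have ellc : {within `[S 0, S c], continuous (ellf k)}.
  by rewrite S0; apply: ellf_within.
rewrite -/(S c) /ellI -[X in `[X, S c]]S0.
rewrite (substitution_is_derive c0 dS sc Smono ellc) -ge0_integralZl//.
- apply: eq_integral => t; rewrite inE /= in_itv /= => /andP[t0 tc].
  rewrite -EFinM; congr EFin.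
  have t1 : t < 1 by lra.
  have xt : 0 < 1 - x * t ^+ 2 by nra.
  have -> : ellf k (S t) = ellf x t * ((1 + x * t ^+ 2) ^+ 2 / (1 - x * t ^+ 2)).
    rewrite /ellf.
    have -> : (1 - S t ^+ 2) * (1 - k ^+ 2 * S t ^+ 2) =
      ((1 - t ^+ 2) * (1 - x ^+ 2 * t ^+ 2)) *
      ((1 - x * t ^+ 2) / (1 + x * t ^+ 2) ^+ 2) ^+ 2.
      have -> : k ^+ 2 = 4 * x / (1 + x) ^+ 2 by rewrite -kx; field; lra.
      by rewrite /S; field; rewrite !gt_eqF//; lra.
    rewrite sqrtrM; last by apply/ltW/radicand_gt0; lra.
    rewrite sqrtr_sqr ger0_norm; last first.
      by apply: divr_ge0; [exact: ltW|rewrite exprn_ge0// ltW].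
    by rewrite invfM invf_div.
  by rewrite /s; field; rewrite !gt_eqF//.
- apply/measurable_EFinP.
  apply: subspace_continuous_measurable_fun; first exact: measurable_itv.
  by apply: ellf_within => //; lra.
- by move=> t _; rewrite lee_fin ellf_ge0.
- by rewrite lee_fin; lra.
Qed.

Lemma ellI1_landen k x : 0 < x < 1 -> 0 <= k < 1 ->
  k ^+ 2 * (1 + x) ^+ 2 = 4 * x ->
  (ellI k 1 = (1 + x)%:E * ellI x 1)%E.
Proof.
move=> x01 k01 kx; have /andP[x0 x1] := x01.
have x01' : 0 <= x < 1 by rewrite ltW.
apply/le_anti/andP; split.
  apply: ellI1_le => // c c01; have /andP[c0 c1] := c01.
  apply: (@le_trans _ _ (ellI k ((1 + x) * c / (1 + x * c ^+ 2)))).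
    apply: ge0_subset_integral => //.
    - apply: (measurable_funS _ _ (ellf_measurable k01)) => //.
      exact: ellI_sub (gauss_map_lt1 x01 c01).
    - by move=> t _; rewrite lee_fin ellf_ge0.
    - move=> t /=; rewrite !in_itv /= => /andP[-> tc] /=.
      apply: le_trans tc _; rewrite ler_pdivlMr; last by nra.
      rewrite mulrC; apply: ler_wpM2r; first exact: ltW.
      rewrite lerD2l; apply: ler_piMr; first exact: ltW.
      by apply: exprn_ile1; exact: ltW.
  rewrite ellI_landen//; apply: lee_wpmul2l; first by rewrite lee_fin; lra.
  exact: ellI_le1.
rewrite -lee_pdivlMl; last by lra.
apply: ellI1_le => // c c01; have /andP[c0 c1] := c01.
rewrite lee_pdivlMl; last by lra.
rewrite -(ellI_landen _ k01)//; by apply: ellI_le1 => //; exact: gauss_map_lt1.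
Qed.

End elliptic.

Section elliptic_bounds.
Variable R : realType.
Implicit Types (k t c x : R).
Local Open Scope classical_set_scope.

(** The integrand is smallest for the modulus 0, where its primitive is [asin]. *)
Lemma ellI1_ge_asin k c : 0 <= k < 1 -> 0 < c < 1 -> ((asin c)%:E <= ellI k 1)%E.
Proof.
move=> k01 /andP[c0 c1]; apply: le_trans (ellI_le1 k01 c1).
have cst0 (t : R) : ellf 0 t = (Num.sqrt (1 - t ^+ 2))^-1.
  by rewrite /ellf expr0n mul0r subr0 mulr1.
have -> : asin c = asin c - asin 0.
  rewrite -[X in _ - asin X]sin0 sinK ?subr0// in_itv /=.
  by have := pi_gt0 R; lra.
have dasin t : 0 <= t <= c -> is_derive t 1 asin (ellf 0 t).
  by move=> /andP[t0 tc]; rewrite cst0; apply: is_derive1_asin; lra.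
have c00 : {within `[0, c], continuous (ellf (0 : R))}.
  by apply: ellf_within; rewrite ?lexx ?ltr01.
rewrite -(FTC_is_derive c0 dasin c00).
- apply: ge0_le_integral => //.
  + by move=> t _; rewrite lee_fin ellf_ge0.
  + apply/measurable_EFinP.
    apply: subspace_continuous_measurable_fun; first exact: measurable_itv.
    by apply: ellf_within; rewrite ?lexx ?ltr01.
  + apply/measurable_EFinP.
    apply: subspace_continuous_measurable_fun; first exact: measurable_itv.
    exact: ellf_within.
  + move=> t /=; rewrite in_itv /= => /andP[t0 tc]; rewrite lee_fin cst0.
    have t01 : 0 <= t < 1 by lra.
    have := radicand_gt0 k01 t01.
    have k0 : 0 <= k ^+ 2 * t ^+ 2 by rewrite mulr_ge0 ?sqr_ge0.
    have t2 : 0 < 1 - t ^+ 2 by nra.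
    move=> r0; rewrite lef_pV2 ?posrE ?sqrtr_gt0//.
    by apply: ler_wsqrtr; apply: ler_piMr; lra.
Qed.

Section upper_bound.
Variables (l k : R).
Hypotheses (l0 : 0 < l) (k0 : 0 < k) (lk : l ^+ 2 + k ^+ 2 = 1).

Let k01 : 0 <= k < 1.
Proof.
have l2 : 0 < l ^+ 2 by rewrite exprn_gt0.
rewrite (ltW k0) -(@expr_lt1 _ 2) ?(ltW k0)//= -lk; lra.
Qed.

Let c0 := l ^+ 2 / 2.
(** With [w = 1 - t], the integrand with modulus k is compared with
    [1 / sqrt (w (w + c0))]. The factor 1/2 is exact at [w = 0], so that the integral
    gets the sharp leading term [ln (1 / l)]; only the bounded remainder is
    estimated crudely. *)
Let h t := k^-1 * ((Num.sqrt (1 - t) * Num.sqrt (1 - t + c0))^-1 / 2 + 2^-1).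
Let H t := k^-1 * (t / 2 - ln (Num.sqrt (1 - t) + Num.sqrt (1 - t + c0))).

Lemma ellf_le_majorant t : 0 <= t < 1 -> ellf k t <= h t.
Proof.
move=> /andP[t0 t1].
pose w := 1 - t; pose s := Num.sqrt w * Num.sqrt (w + c0).
have w0 : 0 < w by rewrite subr_gt0.
have l2 : 0 < l ^+ 2 by rewrite exprn_gt0.
have c00 : 0 < c0 by rewrite /c0; lra.
have s2 : s ^+ 2 = w * (w + c0).
  by rewrite exprMn !sqr_sqrtr//; lra.
have s0 : 0 < s by rewrite mulr_gt0// sqrtr_gt0; lra.
have ws : w <= s by rewrite -ler_sqr ?nnegrE ?(ltW w0) ?(ltW s0)// s2 expr2 ler_pM2l//; lra.
have w2 : 0 < 2 - w by rewrite /w; lra.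
have w1 : w <= 1 by rewrite /w; lra.
have D0 : 0 < k * (2 - w) * s by apply: mulr_gt0 => //; exact: mulr_gt0.
(* [1 - k ^ 2 t ^ 2 >= k ^ 2 (2 - w) (w + c0)] under the root *)
apply: (@le_trans _ _ (k * (2 - w) * s)^-1).
  have r0 := @radicand_gt0 _ k t k01 (introT andP (conj t0 t1)).
  rewrite lef_pV2 ?posrE ?sqrtr_gt0//.
  rewrite -(ger0_norm (ltW D0)) -sqrtr_sqr; apply: ler_wsqrtr.
  rewrite [(_ * s) ^+ 2]exprMn s2 exprMn.
  have -> : t = 1 - w by rewrite /w; ring.
  rewrite -subr_ge0.
  have -> : (1 - (1 - w) ^+ 2) * (1 - k ^+ 2 * (1 - w) ^+ 2) -
     k ^+ 2 * (2 - w) ^+ 2 * (w * (w + c0)) =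
     w * (2 - w) * (l ^+ 2 * (1 - k ^+ 2 * (2 - w) / 2)).
    rewrite /c0; have -> : k ^+ 2 = 1 - l ^+ 2 by rewrite -lk; ring.
    by field.
  apply: mulr_ge0; first exact: mulr_ge0 (ltW w0) (ltW w2).
  apply: mulr_ge0; first exact: ltW.
  have k2 : k ^+ 2 * (2 - w) <= 1 * 2.
    apply: ler_pM; rewrite ?sqr_ge0 ?(ltW w2)//; last by lra.
    by rewrite -lk lerDr ltW.
  lra.
rewrite /h -/w -/s -mulrA invfM ler_wpM2l ?invr_ge0 ?(ltW k0)//.
rewrite -subr_ge0.
have -> : s^-1 / 2 + 2^-1 - ((2 - w) * s)^-1 =
  ((2 - w) * (s - w) + w * (1 - w)) / (2 * (2 - w) * s).
  by field; rewrite !gt_eqF.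
apply: divr_ge0; last by apply: mulr_ge0; [apply: mulr_ge0|]; lra.
by apply: addr_ge0; apply: mulr_ge0; lra.
Qed.

Lemma is_derive_primitive t : t < 1 -> is_derive t 1 H (h t).
Proof.
move=> t1; have w0 : 0 < 1 - t by rewrite subr_gt0.
have c00 : 0 < c0 by rewrite /c0; have : 0 < l ^+ 2 by [rewrite exprn_gt0]; lra.
have dl (c : R) : is_derive t 1 (fun t : R => 1 - t + c) (- 1).
  by apply: is_derive_eq; ring.
have ds (c : R) : 0 < 1 - t + c ->
    is_derive t 1 (fun t : R => Num.sqrt (1 - t + c)) (- (2 * Num.sqrt (1 - t + c))^-1).
  move=> p; have := is_derive1_comp (f := Num.sqrt) (g := fun t : R => 1 - t + c)
    (is_derive1_sqrt p) (dl c).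
  by rewrite mulrN1.
have ds0 : is_derive t 1 (fun t : R => Num.sqrt (1 - t)) (- (2 * Num.sqrt (1 - t))^-1).
  have := ds 0; rewrite addr0 => /(_ w0).
  by have -> : (fun t : R => Num.sqrt (1 - t + 0)) = (fun t : R => Num.sqrt (1 - t));
    [apply/funext => u; rewrite addr0|].
have s10 : 0 < Num.sqrt (1 - t) by rewrite sqrtr_gt0.
have wc : 0 < 1 - t + c0 by lra.
have s20 : 0 < Num.sqrt (1 - t + c0) by rewrite sqrtr_gt0.
have dsum := is_deriveD ds0 (ds c0 wc).
have p0 : 0 < Num.sqrt (1 - t) + Num.sqrt (1 - t + c0) by lra.
have dln := is_derive1_comp (g := fun t => Num.sqrt (1 - t) + Num.sqrt (1 - t + c0))
  (is_derive1_ln p0) dsum.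
have dt2 : is_derive t 1 (fun t : R => t / 2) 2^-1.
  by apply: is_derive_eq; rewrite /GRing.scale /=; ring.
apply: (is_derive_eq (is_deriveZ k^-1 (is_deriveB dt2 dln))).
rewrite /GRing.scale /= /h; congr (_ * _); field.
by rewrite !gt_eqF.
Qed.

Lemma ellI1_le_log : (ellI k 1 <= (k^-1 * (ln (6 / l) + 2^-1))%:E)%E.
Proof.
have lp : 0 < l := l0.
have l2 : 0 < l ^+ 2 by rewrite exprn_gt0.
have k2 : 0 < k ^+ 2 by rewrite exprn_gt0.
have c00 : 0 < c0 by rewrite /c0; lra.
apply: ellI1_le => // c /andP[cp c1].
have hc : {within `[0, c], continuous h}.
  apply: within_continuousP => t /=; rewrite in_itv /= => /andP[t0 tc].
  have t1 : t < 1 by lra.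
  apply: continuousM; first exact: cst_continuous.
  apply: continuousD; last exact: cst_continuous.
  apply: continuousM; last exact: cst_continuous.
  apply: (@continuousV _ _ (fun t : R => Num.sqrt (1 - t) * Num.sqrt (1 - t + c0))).
    by rewrite gt_eqF// mulr_gt0// sqrtr_gt0; lra.
  apply: continuousM.
    apply: continuous_comp; last exact: sqrt_continuous.
    by apply: continuousB; [exact: cst_continuous|exact: cvg_id].
  apply: continuous_comp; last exact: sqrt_continuous.
  apply: continuousD; last exact: cst_continuous.
  by apply: continuousB; [exact: cst_continuous|exact: cvg_id].
  apply: (@le_trans _ _ (H c - H 0)%:E).
    have dH t : 0 <= t <= c -> is_derive t 1 H (h t).
      by move=> /andP[_ tc]; apply: is_derive_primitive; lra.
    rewrite -(FTC_is_derive cp dH hc).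
    apply: ge0_le_integral => //.
    + by move=> t _; rewrite lee_fin ellf_ge0.
    + apply/measurable_EFinP.
      apply: subspace_continuous_measurable_fun; first exact: measurable_itv.
      exact: ellf_within.
    + apply/measurable_EFinP.
      by apply: subspace_continuous_measurable_fun; first exact: measurable_itv.
    + move=> t /=; rewrite in_itv /= => /andP[t0 tc]; rewrite lee_fin.
      by apply: ellf_le_majorant; lra.
  rewrite lee_fin /H -mulrBr; apply: ler_wpM2l; first by rewrite invr_ge0 ltW.
  rewrite subr0 mul0r sub0r opprK sqrtr1.
  (* [H] is bounded, also as c tends to 1. *)
  have a1 : 1 + Num.sqrt (1 + c0) <= 3.
    have : Num.sqrt (1 + c0) <= Num.sqrt (2 ^+ 2).
      have l2le : l ^+ 2 <= 1 by rewrite -lk lerDl ltW.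
      by apply: ler_wsqrtr; rewrite /c0; lra.
    by rewrite sqrtr_sqr ger0_norm//; lra.
  have a2 : l / 2 <= Num.sqrt (1 - c) + Num.sqrt (1 - c + c0).
    apply: (@le_trans _ _ (Num.sqrt c0)).
      rewrite -[l / 2]ger0_norm; last by lra.
      rewrite -sqrtr_sqr; apply: ler_wsqrtr; rewrite /c0.
      have -> : (l / 2) ^+ 2 = l ^+ 2 / 4 by field.
      by lra.
    have : Num.sqrt c0 <= Num.sqrt (1 - c + c0) by apply: ler_wsqrtr; lra.
    by have := sqrtr_ge0 (1 - c); lra.
  have q1 : 0 < 1 + Num.sqrt (1 + c0) by have := sqrtr_ge0 (1 + c0); lra.
  have L1 : ln (1 + Num.sqrt (1 + c0)) <= ln (3 : R).
    by rewrite ler_ln ?posrE//; lra.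
  have L2 : ln (l / 2) <= ln (Num.sqrt (1 - c) + Num.sqrt (1 - c + c0)).
    by rewrite ler_ln ?posrE//; lra.
  have -> : 6 / l = 3 / (l / 2) by field; lra.
  rewrite ln_div ?posrE//; lra.
Qed.

End upper_bound.
End elliptic_bounds.

(** * The Groetzsch function *)

Section grotzsch.
Variable R : realType.
Implicit Types (k l x : R).
Local Open Scope classical_set_scope.

Local Notation compl l := (Num.sqrt (1 - l ^+ 2)).

Lemma compl01 l : 0 < l < 1 -> 0 < compl l < 1.
Proof.
move=> /andP[l0 l1]; have l2 : 0 < l ^+ 2 < 1.
  by rewrite exprn_gt0// expr_lt1// ltW.
apply/andP; split; first by rewrite sqrtr_gt0; lra.
by rewrite -[ltRHS](@sqrtr1 R) ltr_sqrt//; lra.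
Qed.

Lemma sqr_compl l : 0 < l < 1 -> compl l ^+ 2 = 1 - l ^+ 2.
Proof.
move=> /andP[l0 l1]; rewrite sqr_sqrtr// subr_ge0.
by apply: exprn_ile1; rewrite ltW.
Qed.

Lemma complK l : 0 < l < 1 -> compl (compl l) = l.
Proof.
move=> l01; rewrite sqr_compl// opprB addrC subrK sqrtr_sqr ger0_norm//.
by case/andP: l01 => /ltW.
Qed.

Lemma ellipticK_fin k : 0 < k < 1 -> (ellipticK k)%:E = ellI k 1.
Proof.
move=> k01; have /andP[k0 k1] := k01; rewrite /ellipticK /Rintegral fineK//.
have /andP[l0 l1] := compl01 k01.
have kl : compl k ^+ 2 + k ^+ 2 = 1 by rewrite sqr_compl// subrK.
have up := ellI1_le_log l0 k0 kl.
rewrite ge0_fin_numE; last first.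
  by apply: integral_ge0 => t _; rewrite lee_fin ellf_ge0.
exact: le_lt_trans up (ltry _).
Qed.

Lemma ellipticK_le_log l : 0 < l < 1 ->
  ellipticK (compl l) <= (compl l)^-1 * (ln (6 / l) + 2^-1).
Proof.
move=> l01; have k01 := compl01 l01; have /andP[k0 k1] := k01.
rewrite -lee_fin (ellipticK_fin k01); apply: ellI1_le_log => //.
  by case/andP: l01.
by rewrite sqr_compl// addrC subrK.
Qed.

Lemma ellipticK_ge k : 0 < k < 1 -> pi / 2 <= ellipticK k.
Proof.
move=> k01; have /andP[k0 k1] := k01; have p0 := pi_gt0 R.
rewrite leNgt; apply/negP => Klt.
have K0 : 0 <= ellipticK k.
  rewrite -lee_fin (ellipticK_fin k01).
  by apply: integral_ge0 => t _; rewrite lee_fin ellf_ge0.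
pose th := (ellipticK k + pi / 2) / 2.
have th0 : 0 < th < pi / 2 by rewrite /th; lra.
have /andP[th1 th2] := th0.
have sth : asin (sin th) = th by rewrite sinK// in_itv /=; lra.
have s01 : 0 < sin th < 1.
  rewrite sin_gt0_pi ?in_itv/=; last by lra.
  rewrite lt_neqAle sin_le1 andbT; apply/negP => /eqP s1.
  by move: sth; rewrite s1 -(sin_pihalf R) sinK ?in_itv/=; lra.
have := ellI1_ge_asin (introT andP (conj (ltW k0) k1)) s01.
by rewrite -(ellipticK_fin k01) sth lee_fin /th; lra.
Qed.

Lemma ellipticK_gt0 k : 0 < k < 1 -> 0 < ellipticK k.
Proof. by move=> /ellipticK_ge; apply: lt_le_trans; rewrite divr_gt0// pi_gt0. Qed.

Lemma grotzsch_mu_gt0 l : 0 < l < 1 -> 0 < grotzsch_mu l.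
Proof.
move=> l01; rewrite /grotzsch_mu mulr_gt0 ?divr_gt0 ?pi_gt0//.
- exact: ellipticK_gt0 (compl01 l01).
- exact: ellipticK_gt0.
Qed.

Lemma grotzsch_mu_compl l : 0 < l < 1 ->
  grotzsch_mu l * grotzsch_mu (compl l) = pi ^+ 2 / 4.
Proof.
move=> l01; rewrite /grotzsch_mu complK//.
have := ellipticK_gt0 l01; have := ellipticK_gt0 (compl01 l01).
by move=> K1 K2; field; rewrite !gt_eqF.
Qed.

(** The descending Landen transformation of moduli. *)
Definition landen l := (1 - compl l) / (1 + compl l).

Lemma landenE l : 0 < l < 1 -> landen l = l ^+ 2 / (1 + compl l) ^+ 2.
Proof.
move=> l01; have /andP[c0 c1] := compl01 l01; rewrite /landen.
have := sqr_compl l01; move: (compl l) c0 c1 => c c0 c1 cE.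
have -> : l ^+ 2 = 1 - c ^+ 2 by rewrite cE; ring.
by field; rewrite gt_eqF//; lra.
Qed.

Lemma landen_le l : 0 < l < 1 -> landen l <= l ^+ 2.
Proof.
move=> l01; have /andP[c0 c1] := compl01 l01; rewrite landenE//.
rewrite ler_pdivrMr; last by apply: exprn_gt0; lra.
by apply: ler_peMr; rewrite ?sqr_ge0//; apply: exprn_ege1; lra.
Qed.

Lemma landen_ge l : 0 < l < 1 -> l ^+ 2 / 4 <= landen l.
Proof.
move=> l01; have /andP[c0 c1] := compl01 l01; rewrite landenE//.
apply: ler_wpM2l; first exact: sqr_ge0.
have p0 : 0 < (1 + compl l) ^+ 2 by apply: exprn_gt0; lra.
by rewrite lef_pV2 ?posrE//; nra.
Qed.

Lemma landen01 l : 0 < l < 1 -> 0 < landen l < 1.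
Proof.
move=> l01; have /andP[l0 l1] := l01.
apply/andP; split.
  by apply: lt_le_trans (landen_ge l01); rewrite divr_gt0// exprn_gt0.
by apply: le_lt_trans (landen_le l01) _; rewrite expr_lt1// ltW.
Qed.

Lemma ellipticK_gauss k x : 0 < x < 1 -> 0 < k < 1 ->
  k ^+ 2 * (1 + x) ^+ 2 = 4 * x -> ellipticK k = (1 + x) * ellipticK x.
Proof.
move=> x01 k01 kx; apply: EFin_inj.
rewrite EFinM !ellipticK_fin// (ellI1_landen x01 _ kx)//.
by case/andP: k01 => /ltW -> ->.
Qed.

(** Gauss's identity applies twice: it relates the modulus l to its transform x, and
    the complementary modulus of x to the complementary modulus of l. The factors
    combine to 2. *)
Lemma grotzsch_mu_landen l : 0 < l < 1 ->
  grotzsch_mu (landen l) = 2 * grotzsch_mu l.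
Proof.
move=> l01; have c01 := compl01 l01; have /andP[c0 c1] := c01.
have x01 := landen01 l01; have /andP[x0 x1] := x01.
have xE : landen l = (1 - compl l) / (1 + compl l) by [].
have l2 : l ^+ 2 = 1 - compl l ^+ 2 by rewrite sqr_compl//; ring.
have K1 : ellipticK l = (1 + landen l) * ellipticK (landen l).
  apply: ellipticK_gauss => //; rewrite l2 xE; field; rewrite gt_eqF//; lra.
have K2 : ellipticK (compl (landen l)) = (1 + compl l) * ellipticK (compl l).
  apply: ellipticK_gauss => //; first exact: compl01.
  rewrite (sqr_compl x01) xE; field; rewrite gt_eqF//; lra.
rewrite /grotzsch_mu K2 K1 xE; field.
rewrite -xE; have K := ellipticK_gt0 x01.
by apply/and3P; split; rewrite gt_eqF//; lra.
Qed.

Lemma iter_landen01 l n : 0 < l < 1 -> 0 < iter n landen l < 1.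
Proof. by move=> l01; elim: n => [//|n IHn]; apply: landen01. Qed.

Lemma grotzsch_mu_iter l n : 0 < l < 1 ->
  grotzsch_mu (iter n landen l) = 2 ^+ n * grotzsch_mu l.
Proof.
move=> l01; elim: n => [|n IHn]; first by rewrite expr0 mul1r.
by rewrite iterS grotzsch_mu_landen ?iter_landen01// IHn exprS mulrA.
Qed.

Lemma iter_landen_le l n : 0 < l < 1 -> iter n landen l <= l ^+ n.+1.
Proof.
move=> l01; have /andP[l0 l1] := l01.
elim: n => [|n IHn]; first by rewrite expr1.
have /andP[i0 i1] := iter_landen01 n l01.
rewrite iterS; apply: le_trans (landen_le (iter_landen01 n l01)) _.
rewrite expr2 [l ^+ n.+2]exprS; apply: ler_pM => //; try exact: ltW.
apply: le_trans IHn _; rewrite exprS; apply: ler_piMr; first exact: ltW.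
by apply: exprn_ile1; exact: ltW.
Qed.

(** [ln (4 / l)] at most doubles, because [landen l >= l ^ 2 / 4]; this is where the
    constant 4 comes from. *)
Lemma ln_iter_landen l n : 0 < l < 1 ->
  ln (4 / iter n landen l) <= 2 ^+ n * ln (4 / l).
Proof.
move=> l01; elim: n => [|n IHn]; first by rewrite expr0 mul1r.
have i01 := iter_landen01 n l01; have /andP[i0 i1] := i01.
rewrite iterS exprS -mulrA.
apply: (@le_trans _ _ (2 * ln (4 / iter n landen l))); last by rewrite ler_pM2l.
have q0 : 0 < 4 / iter n landen l by rewrite divr_gt0.
have -> : 2 * ln (4 / iter n landen l) =
    ln ((4 / iter n landen l) * (4 / iter n landen l)).
  by rewrite [RHS]lnM ?posrE//; ring.
have /andP[y0 _] := landen01 i01.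
rewrite ler_ln ?posrE ?mulr_gt0 ?invr_gt0// ler_pdivrMr//.
have := landen_ge i01; rewrite -(ler_pM2l (mulr_gt0 q0 q0)); apply: le_trans.
by rewrite le_eqVlt; apply/orP; left; apply/eqP; field; rewrite gt_eqF.
Qed.

(** The constant lost in the logarithmic bound for K is divided by 2 ^ n after n
    Landen steps, so that only the sharp asymptotic value survives. *)
Lemma grotzsch_mu_le l : 0 < l < 1 -> grotzsch_mu l <= ln (4 / l).
Proof.
move=> l01; have /andP[l0 l1] := l01.
(* the loss of [ln (6 / l) + 1 / 2], in [ellipticK_le_log], with respect to [ln (4 / l)] *)
pose C : R := ln (3 / 2) + 2^-1.
have key n : (1 - l ^+ n.+1) * grotzsch_mu l <= ln (4 / l) + C * 2^-1 ^+ n.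
  have i01 := iter_landen01 n l01; have /andP[i0 i1] := i01.
  have /andP[c0 c1] := compl01 i01.
  have mn : compl (iter n landen l) * grotzsch_mu (iter n landen l) <=
      2 ^+ n * ln (4 / l) + C.
    apply: (@le_trans _ _ (ln (6 / iter n landen l) + 2^-1)); last first.
      have -> : 6 / iter n landen l = 4 / iter n landen l * (3 / 2).
        by field; rewrite gt_eqF.
      rewrite lnM ?posrE ?divr_gt0// /C addrA lerD2r lerD2r.
      exact: ln_iter_landen.
    rewrite mulrC -ler_pdivlMr// mulrC.
    apply: le_trans (ellipticK_le_log i01).
    rewrite /grotzsch_mu mulrA ler_pdivrMr ?ellipticK_gt0//.
    rewrite mulrC ler_pM2l; first exact: ellipticK_ge.
    exact: ellipticK_gt0 (compl01 i01).
  rewrite grotzsch_mu_iter// in mn.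
  have m0 := grotzsch_mu_gt0 l01.
  have p0 : 0 < 2 ^+ n :> R by rewrite exprn_gt0.
  have le1 : 1 - l ^+ n.+1 <= compl (iter n landen l).
    apply: (@le_trans _ _ (1 - iter n landen l)).
      by rewrite lerD2l lerN2 iter_landen_le.
    rewrite -ler_sqr ?nnegrE ?(ltW c0) ?subr_ge0 ?(ltW i1)// sqr_compl//.
    move: (iter n landen l) i0 i1 => y y0 y1; nra.
  apply: (@le_trans _ _ (compl (iter n landen l) * grotzsch_mu l)).
    by rewrite ler_pM2r.
  rewrite -(ler_pM2l p0) mulrDr mulrCA.
  have -> : 2 ^+ n * (C * 2^-1 ^+ n) = C.
    by rewrite mulrCA -exprMn divff// expr1n mulr1.
  exact: mn.
have cvl : (1 - l ^+ n.+1) * grotzsch_mu l @[n --> \oo] --> grotzsch_mu l.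
  rewrite -[X in _ --> X]mul1r; apply: cvgM; last exact: cvg_cst.
  rewrite -[X in _ --> X]subr0; apply: cvgB; first exact: cvg_cst.
  have := @cvg_expr R l; rewrite ger0_norm ?(ltW l0)// => /(_ l1).
  by rewrite -(cvg_shiftS (GRing.exp l)).
have cvr : ln (4 / l) + C * 2^-1 ^+ n @[n --> \oo] --> ln (4 / l).
  rewrite -[X in _ --> X]addr0; apply: cvgD; first exact: cvg_cst.
  rewrite -[X in _ --> X](mulr0 C); apply: cvgM; first exact: cvg_cst.
  by apply: cvg_expr; rewrite ger0_norm//; lra.
by apply: (ler_cvg_to cvl cvr); apply: nearW => n; exact: key.
Qed.

End grotzsch.
(** * The theta function *)

Section theta.
Variable R : realType.
Implicit Types (p h x y u v : R).
Local Open Scope classical_set_scope.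

Definition theta_term p x (n : nat) : R := p ^+ (n ^ 2) * cos (n%:R * x).

Definition theta_sum p x (N : nat) : R :=
  1 + 2 * \sum_(1 <= n < N.+1) theta_term p x n.

Definition theta p x : R := lim (theta_sum p x @ \oo).

Lemma theta_sumS p x N :
  theta_sum p x N.+1 = theta_sum p x N + 2 * theta_term p x N.+1.
Proof. by rewrite /theta_sum big_nat_recr//= mulrDr addrA. Qed.

Lemma theta_sum0 p x : theta_sum p x 0 = 1.
Proof. by rewrite /theta_sum big_geq// mulr0 addr0. Qed.

Lemma theta_term_le p x n : 0 < p < 1 -> `|theta_term p x n| <= p ^+ n.
Proof.
move=> /andP[p0 p1]; rewrite normrM ger0_norm ?exprn_ge0 ?(ltW p0)//.
apply: (@le_trans _ _ (p ^+ (n ^ 2))).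
  apply: ler_piMr; first by rewrite exprn_ge0// ltW.
  by rewrite ler_norml cos_geN1 cos_le1.
by apply: ler_wiXn2l; [exact: ltW|exact: ltW|case: n => // n; rewrite leq_pmull].
Qed.

Lemma theta_cvg p x : 0 < p < 1 -> theta_sum p x N @[N --> \oo] --> theta p x.
Proof.
move=> p01; have /andP[p0 p1] := p01.
suff cu : cvgn (series (theta_term p x)).
  suff : cvgn (theta_sum p x) by [].
  have -> : theta_sum p x = fun N => 2 * series (theta_term p x) N.+1 - 1.
    apply/funext => N; rewrite /theta_sum /series /= [in RHS]big_ltn//.
    by rewrite {2}/theta_term exp0n// expr0 mul0r cos0; ring.
  apply: is_cvgB; last exact: is_cvg_cst.
  apply: is_cvgM; first exact: is_cvg_cst.
  have /cvg_ex[l cl] := cu; apply/cvg_ex; exists l.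
  by rewrite (cvg_shiftS (series (theta_term p x))).
apply: normed_cvg; apply: (@series_le_cvg _ _ (GRing.exp p)).
- by move=> n; exact: normr_ge0.
- by move=> n; rewrite exprn_ge0 ?ltW.
- by move=> n; exact: theta_term_le.
- have -> : GRing.exp p = geometric 1 p.
    by apply/funext => n; rewrite /geometric /= mul1r.
  by apply: is_cvg_geometric_series; rewrite ger0_norm// ltW.
Qed.

Lemma thetaN p x : theta p (- x) = theta p x.
Proof.
congr (lim (_ @ \oo)); apply/funext => N; rewrite /theta_sum; congr (1 + 2 * _).
by apply: eq_bigr => n _; rewrite /theta_term mulrN cosN.
Qed.

Lemma cosDnpi2 (n : nat) x : cos (x + n%:R * (2 * pi)) = cos x.
Proof.
elim: n => [|n IHn]; first by rewrite mul0r addr0.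
have -> : x + n.+1%:R * (2 * pi) = x + n%:R * (2 * pi) + pi + pi.
  by rewrite -natr1; ring.
by rewrite !cosDpi opprK.
Qed.

Lemma theta2pi p x : theta p (x + 2 * pi) = theta p x.
Proof.
congr (lim (_ @ \oo)); apply/funext => N; rewrite /theta_sum; congr (1 + 2 * _).
by apply: eq_bigr => n _; rewrite /theta_term mulrDr cosDnpi2.
Qed.

Lemma cosDnpi (n : nat) x : cos (x + n%:R * pi) = (-1) ^+ n * cos x.
Proof.
elim: n => [|n IHn]; first by rewrite mul0r addr0 expr0 mul1r.
by rewrite -natr1 mulrDl mul1r addrA cosDpi IHn exprS mulN1r mulNr.
Qed.

Lemma theta_termDpi p x n : theta_term p (x + pi) n = (-1) ^+ n * theta_term p x n.
Proof. by rewrite /theta_term mulrDr cosDnpi mulrCA. Qed.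

Lemma cvg_double : N.*2 @[N --> \oo] --> \oo.
Proof.
move=> A [n _ nA]; exists n => // N /= nN; apply: nA => /=.
by apply: leq_trans nN _; rewrite -addnn leq_addr.
Qed.

(** Only the terms of even index survive. *)
Lemma theta_bisection h x : 0 < h < 1 ->
  theta h x + theta h (x + pi) = 2 * theta (h ^+ 4) (2 * x).
Proof.
move=> h01; have /andP[h0 h1] := h01.
have h401 : 0 < h ^+ 4 < 1 by rewrite exprn_gt0// expr_lt1// ltW.
have fin N : theta_sum h x N.*2 + theta_sum h (x + pi) N.*2 =
             2 * theta_sum (h ^+ 4) (2 * x) N.
  elim: N => [|N IHN]; first by rewrite !theta_sum0; ring.
  rewrite doubleS !theta_sumS !theta_termDpi mulrDr -IHN.
  have -> : theta_term h x N.*2.+2 = theta_term (h ^+ 4) (2 * x) N.+1.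
    rewrite /theta_term -exprM; congr (h ^+ _ * cos _); first by lia.
    by rewrite -doubleS -mul2n natrM; ring.
  have sg : (-1) ^+ N.*2 = 1 :> R by rewrite -signr_odd odd_double.
  by rewrite [(-1) ^+ N.*2.+2]exprS [(-1) ^+ N.*2.+1]exprS sg; ring.
have c1 := cvg_comp _ _ cvg_double (theta_cvg (x := x) h01).
have c2 := cvg_comp _ _ cvg_double (theta_cvg (x := x + pi) h01).
have c3 : 2 * theta_sum (h ^+ 4) (2 * x) N @[N --> \oo] --> 2 * theta (h ^+ 4) (2 * x).
  by apply: cvgM; [exact: cvg_cst|exact: theta_cvg].
have c4 : 2 * theta_sum (h ^+ 4) (2 * x) N @[N --> \oo] -->
    theta h x + theta h (x + pi).
  under eq_cvg do rewrite -fin.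
  exact: cvgD c1 c2.
by rewrite -(cvg_lim (@Rhausdorff R) c4) (cvg_lim (@Rhausdorff R) c3).
Qed.

Definition zrange (N : nat) : seq int := [seq (i%:Z - N%:Z : int) | i <- iota 0 N.*2.+1].

Lemma mem_zrange N (n : int) : (n \in zrange N) = (`|n| <= N)%N.
Proof.
apply/mapP/idP => [[k]|nN].
  by rewrite mem_iota => kN ->; move: kN; lia.
by exists (absz (n + N%:Z)); [rewrite mem_iota|]; lia.
Qed.

Lemma zrange_uniq N : uniq (zrange N).
Proof. by rewrite map_inj_uniq ?iota_uniq// => i j; lia. Qed.

Lemma zrangeS N : perm_eq (zrange N.+1) (N.+1%:Z :: - N.+1%:Z :: zrange N).
Proof.
apply: uniq_perm; first exact: zrange_uniq.
  rewrite cons_uniq cons_uniq zrange_uniq inE !mem_zrange; lia.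
by move=> n; rewrite mem_zrange in_cons in_cons mem_zrange; lia.
Qed.

Definition zterm p x (n : int) : R := p ^+ (absz n ^ 2) * cos (n%:~R * x).

Lemma theta_sumE p x N : theta_sum p x N = \sum_(n <- zrange N) zterm p x n.
Proof.
elim: N => [|N IHN].
  by rewrite theta_sum0 /zrange /= big_seq1 /zterm mul0r cos0 mulr1.
rewrite theta_sumS IHN (perm_big _ (zrangeS N)) !big_cons /zterm /theta_term.
by rewrite abszN /= mulrNz mulNr cosN; rewrite -!/(zterm p x _); ring.
Qed.

End theta.

(** * The bilinear identity *)

Section theta_bilinear.
Variable R : realType.
Implicit Types (p h x y u v : R).
Local Open Scope classical_set_scope.

Lemma geometric_sum_le (b : R) N : 0 < b < 1 -> \sum_(i < N) b ^+ i <= (1 - b)^-1.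
Proof.
move=> /andP[b0 b1]; rewrite -[leRHS]mul1r ler_pdivlMr ?subr_gt0//.
rewrite mulrC -opprB mulNr -subrX1 opprB lerBlDr lerDl.
by rewrite exprn_ge0// ltW.
Qed.

Lemma natr_expr_le (b : R) N : 0 < b < 1 -> N.+1%:R * b ^+ N <= (1 - b)^-1.
Proof.
move=> b01; have /andP[b0 b1] := b01.
have -> : N.+1%:R * b ^+ N = \sum_(i < N.+1) b ^+ N.
  by rewrite sumr_const card_ord mulr_natl.
apply: le_trans (geometric_sum_le N.+1 b01); apply: ler_sum => i _.
by apply: ler_wiXn2l; [exact: ltW|exact: ltW|rewrite -ltnS].
Qed.

Lemma sqr_natr_expr_cvg0 p : 0 < p < 1 ->
  N.+1%:R ^+ 2 * p ^+ N @[N --> \oo] --> 0.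
Proof.
move=> /andP[p0 p1]; (* [b ^ 4 = p]: two factors [b ^ N] absorb the two factors [N + 1]. *)
pose b := Num.sqrt (Num.sqrt p).
have b0 : 0 < b by rewrite !sqrtr_gt0.
have b4 : (b ^+ 2) ^+ 2 = p by rewrite !sqr_sqrtr ?sqrtr_ge0// ltW.
have b1 : b < 1.
  by rewrite -(@expr_lt1 _ 4) ?(ltW b0)// (exprM b 2 2) b4.
have b2 : b ^+ 2 < 1 by rewrite expr_lt1// ltW.
pose K := (1 - b)^-1; have K0 : 0 < K by rewrite invr_gt0 subr_gt0.
have bnd N : N.+1%:R * b ^+ N <= K by apply: natr_expr_le; rewrite b0.
apply: (@squeeze_cvgr _ _ _ _ (fun=> 0) (fun N => K ^+ 2 * (b ^+ 2) ^+ N)).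
- apply: nearW => N; apply/andP; split.
    by rewrite mulr_ge0 ?sqr_ge0// exprn_ge0// ltW.
  have -> : N.+1%:R ^+ 2 * p ^+ N = (N.+1%:R * b ^+ N) ^+ 2 * (b ^+ 2) ^+ N.
    have e : ((b ^+ 2) ^+ 2) ^+ N = b ^+ N * b ^+ N * (b ^+ 2) ^+ N.
      by rewrite -!exprM -!exprD; congr (b ^+ _); lia.
    by rewrite -b4 e; ring.
  rewrite ler_wpM2r ?exprn_ge0 ?sqr_ge0 ?(ltW b0)//.
  by rewrite ler_sqr ?nnegrE ?(ltW K0)// mulr_ge0// exprn_ge0// ltW.
- exact: cvg_cst.
- rewrite -(mulr0 (K ^+ 2)); apply: cvgM; first exact: cvg_cst.
  by apply: cvg_expr; rewrite ger0_norm ?sqr_ge0.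
Qed.

Definition zbox (N : nat) : seq (int * int) :=
  [seq (n, m) | n <- zrange N, m <- zrange N].

Lemma mem_zbox N (z : int * int) :
  (z \in zbox N) = (`|z.1| <= N)%N && (`|z.2| <= N)%N.
Proof.
apply/allpairsP/idP => [[[n m]] /= [+ + ->]|]; first by rewrite !mem_zrange => -> ->.
by case: z => n m /= /andP[nN mN]; exists (n, m); rewrite !mem_zrange.
Qed.

Lemma zbox_uniq N : uniq (zbox N).
Proof. by apply: allpairs_uniq; rewrite ?zrange_uniq// => -[? ?] [? ?]. Qed.

Lemma size_zbox N : size (zbox N) = (N.*2.+1 * N.*2.+1)%N.
Proof. by rewrite size_allpairs size_map size_iota. Qed.

Lemma zrangeN N : perm_eq (zrange N) [seq - n | n <- zrange N].
Proof.
apply: uniq_perm; first exact: zrange_uniq.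
  by rewrite map_inj_uniq ?zrange_uniq//; exact: oppr_inj.
move=> n; apply/idP/mapP => [nN|[m mN ->]]; last by move: mN; rewrite !mem_zrange abszN.
by exists (- n); rewrite ?opprK// mem_zrange abszN -mem_zrange.
Qed.

Definition wave p x y (z : int * int) : R :=
  p ^+ (absz z.1 ^ 2 + absz z.2 ^ 2) * cos (z.1%:~R * x + z.2%:~R * y).

(** The products of sines cancel, since the range of summation is symmetric. *)
Lemma theta_sumM p x y N :
  theta_sum p x N * theta_sum p y N = \sum_(z <- zbox N) wave p x y z.
Proof.
have odd0 : \sum_(m <- zrange N) p ^+ (absz m ^ 2) * sin (m%:~R * y) = 0.
  set S := \sum_(m <- _) _; have : S = - S.
    rewrite {1}/S (perm_big _ (zrangeN N)) big_map /S -sumrN.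
    by apply: eq_bigr => m _; rewrite abszN mulrNz mulNr sinN mulrN.
  by lra.
rewrite !theta_sumE big_allpairs mulr_suml; apply: eq_bigr => n _.
transitivity (zterm p x n * (\sum_(m <- zrange N) zterm p y m) -
   p ^+ (absz n ^ 2) * sin (n%:~R * x) *
     \sum_(m <- zrange N) p ^+ (absz m ^ 2) * sin (m%:~R * y)).
  by rewrite odd0 mulr0 subr0.
rewrite !mulr_sumr -sumrB; apply: eq_bigr => m _.
by rewrite /wave /zterm /= cosD exprD; ring.
Qed.

Lemma cosDzpi (n : int) x : cos (x + n%:~R * pi) = (-1) ^+ absz n * cos x.
Proof.
case: n => n; first by rewrite -pmulrn cosDnpi.
rewrite NegzE mulrNz mulNr -[X in _ = _ * X]cosN abszN /= -cosDnpi.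
by rewrite -cosN; congr cos; rewrite -pmulrn; ring.
Qed.

Lemma wave_Dpi p x y z :
  wave p (x + pi) (y + pi) z = (-1) ^+ absz (z.1 + z.2) * wave p x y z.
Proof.
rewrite /wave mulrCA -cosDzpi; congr (_ * cos _).
by rewrite rmorphD /=; ring.
Qed.

Definition rot45 (z : int * int) : int * int := (z.1 + z.2, z.1 - z.2).

Lemma wave_rot45 h u v z : wave h u v (rot45 z) = wave (h ^+ 2) (u + v) (u - v) z.
Proof.
rewrite /wave /rot45 /= -exprM; congr (h ^+ _ * cos _).
  have sq (n : int) : ((absz n ^ 2)%N : int) = n * n by case: n => n //=; lia.
  suff : ((absz (z.1 + z.2)%R ^ 2 + absz (z.1 - z.2)%R ^ 2)%N : int) =
    (2 * (absz z.1 ^ 2 + absz z.2 ^ 2))%N by case.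
  by rewrite PoszM !PoszD !sq; ring.
by rewrite rmorphD rmorphB /=; ring.
Qed.

(** The preimage of a box under [rot45]. *)
Definition in_diamond (M : nat) (z : int * int) : bool :=
  (`|(rot45 z).1| <= M)%N && (`|(rot45 z).2| <= M)%N.

Lemma int_half (z : int) : ~~ odd (absz z) -> exists n : int, z = n + n.
Proof.
case: z => n /= ev; first by exists n./2%:Z; rewrite -PoszD addnn even_halfK.
exists (- n.+1./2%:Z); rewrite -opprD -PoszD addnn NegzE.
by rewrite even_halfK.
Qed.

Lemma rot45_inj : injective rot45.
Proof.
move=> [a b] [c d] [H1 H2].
have e : a = c by lia.
by rewrite e; congr pair; rewrite e in H1; exact: addrI H1.
Qed.

(** The first coordinate of the preimage is half of the even sum. *)
Lemma rot45_surj (z : int * int) : ~~ odd (absz (z.1 + z.2)) ->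
  exists w, z = rot45 w.
Proof.
case: z => a b /int_half[n abn]; rewrite /= in abn.
exists (n, a - n); rewrite /rot45 /=; congr pair; first by rewrite addrC subrK.
by rewrite opprB addrA -abn addrAC subrr add0r.
Qed.

Lemma odd_rot45 w : ~~ odd (absz ((rot45 w).1 + (rot45 w).2)).
Proof.
case: w => n m; rewrite /rot45 /= addrACA addrN addr0 -mulr2n -mulr_natl.
by rewrite abszM oddM.
Qed.

Lemma diamond_zbox M w : in_diamond M w -> w \in zbox M.
Proof.
case: w => n m; rewrite mem_zbox /in_diamond /rot45 /= => /andP[H1 H2].
by apply/andP; split; lia.
Qed.

Lemma sum_rot45 (f : int * int -> R) M :
  \sum_(z <- zbox M | ~~ odd (absz (z.1 + z.2))) f z =
  \sum_(z <- zbox M | in_diamond M z) f (rot45 z).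
Proof.
rewrite -[LHS]big_filter -[RHS]big_filter -[RHS](big_map rot45 xpredT).
apply: perm_big; apply: uniq_perm; first by rewrite filter_uniq ?zbox_uniq.
  by rewrite map_inj_uniq ?filter_uniq ?zbox_uniq//; exact: rot45_inj.
move=> z; rewrite mem_filter mem_zbox; apply/idP/mapP.
  case/andP => /rot45_surj[w ->] wM; exists w => //.
  by rewrite mem_filter diamond_zbox ?andbT.
by case=> w; rewrite mem_filter => /andP[wM _] ->; rewrite odd_rot45.
Qed.

End theta_bilinear.

Section theta_identities.
Variable R : realType.
Implicit Types (p h x y u v a : R).
Local Open Scope classical_set_scope.

Lemma sqr01 h : 0 < h < 1 -> 0 < h ^+ 2 < 1.
Proof. by move=> /andP[h0 h1]; rewrite exprn_gt0// expr_lt1// ltW. Qed.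

Lemma wave_le p x y z N : 0 < p < 1 -> z \notin zbox N ->
  `|wave p x y z| <= p ^+ N.
Proof.
move=> /andP[p0 p1]; rewrite mem_zbox => zN.
rewrite normrM ger0_norm ?exprn_ge0 ?(ltW p0)//.
apply: (@le_trans _ _ (p ^+ (absz z.1 ^ 2 + absz z.2 ^ 2))).
  apply: ler_piMr; first by rewrite exprn_ge0// ltW.
  by rewrite ler_norml cos_geN1 cos_le1.
apply: ler_wiXn2l; [exact: ltW|exact: ltW|].
have sq (n : nat) : (n <= n ^ 2)%N by case: n => // n; rewrite leq_pmull.
have := sq (absz z.1); have := sq (absz z.2); move: zN.
move: (absz z.1) (absz z.2) => a b; move: (a ^ 2)%N (b ^ 2)%N; lia.
Qed.

(** Rotating the lattice of exponents by 45 degrees: the substitution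
    [(a, b) = (n + m, n - m)] identifies the pairs [(n, m)] with the pairs [(a, b)]
    of equal parity, and [a ^ 2 + b ^ 2 = 2 (n ^ 2 + m ^ 2)]. *)
Lemma theta_bilinear h u v : 0 < h < 1 ->
  2 * (theta (h ^+ 2) (u + v) * theta (h ^+ 2) (u - v)) =
  theta h u * theta h v + theta h (u + pi) * theta h (v + pi).
Proof.
move=> h01; have p01 := sqr01 h01; have /andP[p0 p1] := p01.
pose p := h ^+ 2; pose x := u + v; pose y := u - v.
(* The box of size 2 N in (a, b) corresponds to a diamond in (n, m) that contains the
   box of size N; all the terms of the diamond outside it are tiny. *)
pose E N := theta_sum h u N.*2 * theta_sum h v N.*2 +
  theta_sum h (u + pi) N.*2 * theta_sum h (v + pi) N.*2 -
  2 * (theta_sum p x N * theta_sum p y N).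
have EE N : E N = 2 * \sum_(z <- zbox N.*2 | in_diamond N.*2 z && (z \notin zbox N))
    wave p x y z.
  rewrite /E !theta_sumM -big_split /=.
  transitivity (2 * (\sum_(z <- zbox N.*2 | ~~ odd (absz (z.1 + z.2))) wave h u v z) -
      2 * \sum_(z <- zbox N) wave p x y z).
    congr (_ - _); rewrite [in RHS]big_mkcond mulr_sumr; apply: eq_bigr => z _.
    by rewrite wave_Dpi -signr_odd; case: odd => /=; rewrite ?expr1 ?expr0; ring.
  rewrite sum_rot45 -mulrBr; congr (2 * _).
  under [X in X - _ = _]eq_bigr do rewrite wave_rot45.
  rewrite (bigID (mem (zbox N)))/= addrAC.
  suff -> : \sum_(z <- zbox N.*2 | in_diamond N.*2 z && (z \in zbox N))
      wave (h ^+ 2) (u + v) (u - v) z = \sum_(z <- zbox N) wave p x y z.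
    by rewrite subrr add0r.
  rewrite -[LHS]big_filter.
  apply: perm_big; apply: uniq_perm; rewrite ?filter_uniq ?zbox_uniq//.
  move=> z; rewrite mem_filter !mem_zbox /in_diamond /rot45 /=.
  by apply/idP/idP; lia.
have Ele N : `|E N| <= 32 * (N.+1%:R ^+ 2 * p ^+ N).
  rewrite EE normrM ger0_norm//.
  have -> : 32 * (N.+1%:R ^+ 2 * p ^+ N) = 2 * (16 * (N.+1%:R ^+ 2 * p ^+ N)) by ring.
  apply: ler_wpM2l => //.
  apply: le_trans (ler_norm_sum _ _ _) _.
  apply: (@le_trans _ _ (\sum_(z <- zbox N.*2) p ^+ N)).
    rewrite big_mkcond; apply: ler_sum => z _; case: ifP => [/andP[_]|_].
      exact: wave_le.
    by rewrite exprn_ge0// ltW.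
  rewrite big_const_seq count_predT size_zbox iter_addr_0 -[leLHS]mulr_natl mulrA.
  apply: ler_wpM2r; first by rewrite exprn_ge0// ltW.
  by rewrite -natrX -natrM ler_nat -!addnn; nia.
have cE : E N @[N --> \oo] --> theta h u * theta h v +
    theta h (u + pi) * theta h (v + pi) - 2 * (theta p x * theta p y).
  have cd z := cvg_comp _ _ cvg_double (theta_cvg (x := z) h01).
  apply: cvgB; first by apply: cvgD; apply: cvgM; exact: cd.
  by apply: cvgM; [exact: cvg_cst|apply: cvgM; exact: theta_cvg].
have cB : 32 * (N.+1%:R ^+ 2 * p ^+ N) @[N --> \oo] --> (0 : R).
  rewrite -[X in _ --> X](mulr0 32); apply: cvgM; first exact: cvg_cst.
  exact: sqr_natr_expr_cvg0.
have cE0 : E N @[N --> \oo] --> (0 : R).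
  apply: (squeeze_cvgr (f := fun N => - (32 * (N.+1%:R ^+ 2 * p ^+ N))) _ _ cB).
    by apply: nearW => N; rewrite -ler_norml.
  by rewrite -oppr0; apply: cvgN.
have /eqP : theta h u * theta h v + theta h (u + pi) * theta h (v + pi) -
    2 * (theta p x * theta p y) = 0.
  by rewrite -(cvg_lim (@Rhausdorff R) cE) (cvg_lim (@Rhausdorff R) cE0).
by rewrite subr_eq0 => /eqP ->.
Qed.

End theta_identities.

(** * The product formula *)

Section triple_product.
Variable R : realType.
Implicit Types (p h x y : R).
Local Open Scope classical_set_scope.

Definition theta_factor (s x : R) : R := 1 + 2 * s * cos x + s ^+ 2.

Definition theta_prod p x (N : nat) : R :=
  \prod_(m < N) theta_factor (p ^+ m.*2.+1) x.

(** Summation by parts for [2 cos x cos (n x) = cos ((n + 1) x) + cos ((n - 1) x)],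
    with the boundary terms of the truncation. *)
Lemma cos_series_mul (d : nat -> R) x N :
  (d 0%N + 2 * \sum_(1 <= n < N.+1) d n * cos (n%:R * x)) * (2 * cos x) =
  2 * d 1%N + 2 * (\sum_(1 <= n < N.+1) (d n.-1 + d n.+1) * cos (n%:R * x)) +
  2 * d N * cos (N.+1%:R * x) - 2 * d N.+1 * cos (N%:R * x).
Proof.
elim: N => [|N IHN].
  by rewrite !big_geq// mul0r cos0 mul1r; ring.
rewrite !(big_nat_recr N.+1)//= !mulrDr addrA mulrDl IHN.
have -> : N.+2%:R * x = N.+1%:R * x + x by rewrite -natr1 mulrDl mul1r.
have -> : N%:R * x = N.+1%:R * x - x by rewrite -natr1; ring.
by rewrite !cosD cosN sinN; ring.
Qed.

(** [p ^+ (n ^ 2) * trunc_coef p N n] is the n-th cosine coefficient of the finite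
    product, scaled so that the constant term is 1: a ratio of two q-binomial
    coefficients. The natural subtraction makes it vanish for [N < n]. *)
Definition trunc_coef p (N n : nat) : R :=
  \prod_(j < n) ((1 - (p ^+ 2) ^+ (N - j)) / (1 - (p ^+ 2) ^+ (N.+1 + j))).

(** The inverse of the constant term of the finite product. *)
Definition trunc_scale p (N : nat) : R :=
  \prod_(m < N) ((1 - (p ^+ 2) ^+ m.+1) ^+ 2 /
    ((1 - (p ^+ 2) ^+ m.*2.+1) * (1 - (p ^+ 2) ^+ m.*2.+2))).

Section fixed_p.
Variables (p : R).
Hypothesis p01 : 0 < p < 1.
Let Q := p ^+ 2.

Let p0 : 0 < p. Proof. by case/andP: p01. Qed.

Let Q01 : 0 < Q < 1. Proof. exact: sqr01. Qed.

Let oneBQ n : 0 < 1 - Q ^+ n.+1.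
Proof.
by have /andP[Q0 Q1] := Q01; rewrite subr_gt0 exprn_ilt1// ltW.
Qed.

Let oneBQn0 n : 1 - Q ^+ n.+1 != 0.
Proof. by rewrite gt_eqF. Qed.

Lemma trunc_coefS N n : trunc_coef p N n.+1 =
  trunc_coef p N n * ((1 - Q ^+ (N - n)) / (1 - Q ^+ (N.+1 + n))).
Proof. by rewrite /trunc_coef big_ord_recr. Qed.

Lemma trunc_coef0 N : trunc_coef p N 0 = 1.
Proof. by rewrite /trunc_coef big_ord0. Qed.

Lemma trunc_coef_eq0 N n : (N < n)%N -> trunc_coef p N n = 0.
Proof.
move=> Nn; rewrite /trunc_coef (bigD1 (Ordinal Nn))//= subnn expr0 subrr.
by rewrite !mul0r.
Qed.

Lemma trunc_coefSS N n : trunc_coef p N.+1 n.+1 = trunc_coef p N n *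
  ((1 - Q ^+ N.+1) ^+ 2 / ((1 - Q ^+ (N.+1 + n)) * (1 - Q ^+ (N.+2 + n)))).
Proof.
elim: n => [|n IHn].
  rewrite trunc_coefS !trunc_coef0 subn0 !addn0.
  by field; rewrite !oneBQn0.
rewrite trunc_coefS IHn [in RHS]trunc_coefS subSS !addSn !addnS.
by field; rewrite !oneBQn0.
Qed.

Let kappa N := (1 - Q ^+ N.+1) ^+ 2 / ((1 - Q ^+ N.*2.+1) * (1 - Q ^+ N.*2.+2)).

Let pE n : p ^+ n.*2.+1 = p * Q ^+ n.
Proof. by rewrite exprS -mul2n exprM. Qed.

Lemma trunc_step0 N :
  1 = kappa N * (1 + (p ^+ N.*2.+1) ^+ 2 +
        2 * p ^+ N.*2.+1 * (p * trunc_coef p N 1)).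
Proof.
have e1 := oneBQn0 N.*2; have e2 := oneBQn0 N.*2.+1; have e3 := oneBQn0 N.
rewrite /kappa pE trunc_coefS trunc_coef0 subn0 addn0.
have E1 : Q ^+ N.*2.+1 = Q * Q ^+ N ^+ 2 by rewrite exprS -muln2 exprM.
have E2 : Q ^+ N.*2.+2 = (Q * Q ^+ N) ^+ 2 by rewrite exprS E1; ring.
move: e1 e2 e3; rewrite E1 E2 [Q ^+ N.+1]exprS /Q; move: ((p ^+ 2) ^+ N) => A e1 e2 e3.
by field; rewrite e3 e2 /= exprMn.
Qed.

Lemma trunc_step N n : (n < N)%N ->
  p ^+ (n.+1 ^ 2) * trunc_coef p N.+1 n.+1 =
  kappa N * ((1 + (p ^+ N.*2.+1) ^+ 2) * (p ^+ (n.+1 ^ 2) * trunc_coef p N n.+1) +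
    p ^+ N.*2.+1 * (p ^+ (n ^ 2) * trunc_coef p N n +
                    p ^+ (n.+2 ^ 2) * trunc_coef p N n.+2)).
Proof.
move=> nN; have [D ND] : exists D, N = (D + n.+1)%N by exists (N - n.+1)%N; lia.
have e1 := oneBQn0 N.*2; have e2 := oneBQn0 N.*2.+1; have e3 := oneBQn0 N.
have e4 := oneBQn0 (N + n); have e5 := oneBQn0 (N.+1 + n).
rewrite /kappa trunc_coefSS !trunc_coefS pE.
have -> : (N - n = D.+1)%N by lia.
have -> : (N - n.+1 = D)%N by lia.
have -> : p ^+ (n.+1 ^ 2) = p ^+ (n ^ 2) * (p * Q ^+ n).
  by rewrite -pE -exprD; congr (p ^+ _); nia.
have -> : p ^+ (n.+2 ^ 2) = p ^+ (n ^ 2) * (Q * Q ^+ n) ^+ 2.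
  by rewrite -exprS -!exprM -exprD; congr (p ^+ _); nia.
have AE : Q ^+ N = Q ^+ D * (Q * Q ^+ n) by rewrite ND exprD exprS.
have E1 : Q ^+ N.*2.+1 = Q * Q ^+ N ^+ 2 by rewrite exprS -muln2 exprM.
have E2 : Q ^+ N.*2.+2 = (Q * Q ^+ N) ^+ 2 by rewrite exprS E1; ring.
have E4 : Q ^+ (N.+1 + n) = Q * Q ^+ N * Q ^+ n by rewrite addSn exprS exprD mulrA.
have E5 : Q ^+ (N.+2 + n) = Q ^+ 2 * Q ^+ N * Q ^+ n.
  by rewrite !addSn !exprS exprD; ring.
have E6 : Q ^+ (N.+1 + n.+1) = Q ^+ 2 * Q ^+ N * Q ^+ n by rewrite addnS -addSn.
move: e1 e2 e3 e4 e5; rewrite E1 E2 E4 E5 E6 [Q ^+ N.+1]exprS [Q ^+ D.+1]exprS AE /Q.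
move: ((p ^+ 2) ^+ D) (_ ^+ n) (trunc_coef _ _ _) (p ^+ (n ^ 2)) => X Y r g e1 e2 e3 e4 e5.
have {}e1 : 1 - p ^+ 2 * (X ^+ 2 * (p ^+ 4 * Y ^+ 2)) != 0.
  by have -> : X ^+ 2 * (p ^+ 4 * Y ^+ 2) = (X * (p ^+ 2 * Y)) ^+ 2 by ring.
have {}e5 : 1 - p ^+ 4 * (X * (p ^+ 2 * Y)) * Y != 0 by move: e5; rewrite -exprM.
by field; rewrite e5 e4 e2 e1.
Qed.

Lemma trunc_step_last N :
  p ^+ (N.+1 ^ 2) * trunc_coef p N.+1 N.+1 =
  kappa N * (p ^+ N.*2.+1 * (p ^+ (N ^ 2) * trunc_coef p N N)).
Proof.
rewrite trunc_coefSS /kappa.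
have -> : p ^+ (N.+1 ^ 2) = p ^+ N.*2.+1 * p ^+ (N ^ 2).
  by rewrite -exprD; congr (p ^+ _); nia.
by rewrite !addSn addnn; ring.
Qed.

(** The finite form of Jacobi's identity: the coefficients satisfy the recurrence
    obtained by multiplying the product by one more factor. *)
Lemma triple_product_finite x N :
  trunc_scale p N * theta_prod p x N =
  1 + 2 * \sum_(1 <= n < N.+1) trunc_coef p N n * theta_term p x n.
Proof.
pose d N n := p ^+ (n ^ 2) * trunc_coef p N n.
have dE M : \sum_(1 <= n < M.+1) trunc_coef p N n * theta_term p x n =
    \sum_(1 <= n < M.+1) d N n * cos (n%:R * x).
  by apply: eq_bigr => n _; rewrite /theta_term /d; ring.
rewrite dE {dE}; elim: N => [|N IHN].
  by rewrite /trunc_scale /theta_prod !big_ord0 big_geq// mulr0 addr0 mulr1.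
have d0 M : d M 0%N = 1 by rewrite /d trunc_coef0 exp0n// expr0 mulr1.
have dN1 : d N N.+1 = 0 by rewrite /d trunc_coef_eq0// mulr0.
have d1 : d N 1%N = p * trunc_coef p N 1 by rewrite /d expr1.
rewrite /trunc_scale /theta_prod !big_ord_recr /= -/(kappa N).
rewrite -/(trunc_scale p N) -/(theta_prod p x N) mulrACA IHN mulrC.
have := cos_series_mul (d N) x N; rewrite d0 dN1 mulr0 mul0r subr0.
set S := \sum_(1 <= n < N.+1) d N n * _ => SE.
rewrite big_nat_recr//= -/(d N.+1) [X in _ = 1 + 2 * (_ + X * _)]trunc_step_last.
have -> : \sum_(1 <= n < N.+1) d N.+1 n * cos (n%:R * x) = kappa N * (
   (1 + (p ^+ N.*2.+1) ^+ 2) * S +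
   p ^+ N.*2.+1 * \sum_(1 <= n < N.+1) (d N n.-1 + d N n.+1) * cos (n%:R * x)).
  rewrite /S !mulr_sumr -big_split/= mulr_sumr big_nat [RHS]big_nat.
  apply: eq_bigr => -[//|n] /andP[_ nN]; rewrite /d trunc_step//=; ring.
have := trunc_step0 N; rewrite -d1 /theta_factor -/(d N N).
set s := p ^+ N.*2.+1; set T := \sum_(1 <= n < N.+1) _ in SE * => E0.
transitivity (kappa N * ((1 + s ^+ 2) * (1 + 2 * S) + s * ((1 + 2 * S) * (2 * cos x)))).
  by ring.
by rewrite SE [X in _ = X + _]E0; ring.
Qed.

Lemma trunc_coef_bounds N n : (n <= N)%N ->
  0 <= trunc_coef p N n <= 1 /\
  1 - trunc_coef p N n <= n%:R * Q ^+ (N.+1 - n).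
Proof.
have /andP[Q0 Q1] := Q01.
elim: n => [_|n IHn nN]; first by rewrite trunc_coef0 ler01 lexx subrr mul0r.
have [/andP[r0 r1] Hr] := IHn (ltnW nN); rewrite trunc_coefS.
set f := _ / _; have -> : (N.+1 - n.+1 = N - n)%N by lia.
have q0 : 0 <= Q ^+ (N - n) by rewrite exprn_ge0// ltW.
have q1 : Q ^+ (N - n) <= 1 by apply: exprn_ile1; exact: ltW.
have den : 0 < 1 - Q ^+ (N.+1 + n) by rewrite addSn.
have f0 : 0 <= f by apply: divr_ge0; [rewrite subr_ge0|exact: ltW].
have f1 : f <= 1.
  rewrite ler_pdivrMr// mul1r lerD2l lerN2.
  apply: ler_wiXn2l; [exact: ltW|exact: ltW|].
  exact: leq_trans (leq_subr n N) (leq_trans (leqnSn N) (leq_addr n N.+1)).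
have f2 : 1 - Q ^+ (N - n) <= f.
  rewrite ler_pdivlMr//; apply: ler_piMr; first by rewrite subr_ge0.
  by rewrite gerBl exprn_ge0// ltW.
have q2 : Q ^+ (N.+1 - n) <= Q ^+ (N - n).
  by apply: ler_wiXn2l; [exact: ltW|exact: ltW|exact: leq_sub2r].
split; first by rewrite mulr_ge0//= mulr_ile1.
have : n%:R * Q ^+ (N.+1 - n) <= n%:R * Q ^+ (N - n) by rewrite ler_wpM2l.
rewrite -natr1 mulrDl mul1r; move: Hr; nra.
Qed.

Lemma trunc_scale_gt0 N : 0 < trunc_scale p N.
Proof.
apply: prodr_gt0 => m _.
by apply: divr_gt0; [apply: exprn_gt0|apply: mulr_gt0]; exact: oneBQ.
Qed.

(** Jacobi's triple product, up to the value of the constant factor. *)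
Lemma triple_product x :
  trunc_scale p N * theta_prod p x N @[N --> \oo] --> theta p x.
Proof.
have err N : `|trunc_scale p N * theta_prod p x N - theta_sum p x N| <=
    2 * (N.+1%:R ^+ 2 * p ^+ N).
  have /andP[_ p1] := p01.
  have sub (a b : R) : 1 + 2 * a - (1 + 2 * b) = 2 * (a - b) by ring.
  rewrite triple_product_finite /theta_sum sub -sumrB.
  rewrite normrM ger0_norm// ler_wpM2l//.
  apply: le_trans (ler_norm_sum _ _ _) _.
  apply: (@le_trans _ _ (\sum_(1 <= n < N.+1) N.+1%:R * p ^+ N)).
    rewrite big_nat [leRHS]big_nat; apply: ler_sum => n /andP[n0 nN].
    have [/andP[r0 r1] Hr] := @trunc_coef_bounds N n nN.
    have -> : trunc_coef p N n * theta_term p x n - theta_term p x n =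
      - (1 - trunc_coef p N n) * theta_term p x n by ring.
    rewrite normrM normrN [`|1 - _|]ger0_norm ?subr_ge0//.
    have tn : `|theta_term p x n| <= p ^+ (n ^ 2).
      rewrite normrM ger0_norm ?exprn_ge0 ?(ltW p0)//.
      apply: ler_piMr; first by rewrite exprn_ge0// ltW.
      by rewrite ler_norml cos_geN1 cos_le1.
    apply: (@le_trans _ _ (n%:R * Q ^+ (N.+1 - n) * p ^+ (n ^ 2))).
      by apply: ler_pM; rewrite ?subr_ge0.
    rewrite -mulrA; apply: ler_pM => //.
    - by rewrite mulr_ge0// exprn_ge0// ltW// exprn_gt0.
    - by rewrite ler_nat ltnW.
    - rewrite /Q -exprM -exprD; apply: ler_wiXn2l; [exact: ltW|exact: ltW|].
      by nia.
  rewrite big_const_nat subSS subn0 iter_addr_0 -[leLHS]mulr_natl mulrA.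
  rewrite ler_wpM2r ?exprn_ge0 ?(ltW p0)// expr2.
  by rewrite -!natrM ler_nat; nia.
have cB : 2 * (N.+1%:R ^+ 2 * p ^+ N) @[N --> \oo] --> (0 : R).
  rewrite -[X in _ --> X](mulr0 2); apply: cvgM; first exact: cvg_cst.
  exact: sqr_natr_expr_cvg0.
have c0 : trunc_scale p N * theta_prod p x N - theta_sum p x N @[N --> \oo] --> (0 : R).
  apply: (squeeze_cvgr (f := fun N => - (2 * (N.+1%:R ^+ 2 * p ^+ N))) _ _ cB).
    by apply: nearW => N; rewrite -ler_norml.
  by rewrite -oppr0; apply: cvgN.
have -> : (fun N => trunc_scale p N * theta_prod p x N) =
   (fun N => trunc_scale p N * theta_prod p x N - theta_sum p x N + theta_sum p x N).
  by apply/funext => N; rewrite subrK.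
by rewrite -[X in _ --> X]add0r; apply: (cvgD c0); exact: theta_cvg.
Qed.

Lemma theta_factor_ge0 s x : 0 <= theta_factor s x.
Proof.
have := cos2Dsin2 x; rewrite /theta_factor => cs.
have -> : 1 + 2 * s * cos x + s ^+ 2 = (s + cos x) ^+ 2 + (1 - cos x ^+ 2) by ring.
by rewrite addr_ge0 ?sqr_ge0// -cs addrC addKr sqr_ge0.
Qed.

Lemma theta_ge0 x : 0 <= theta p x.
Proof.
rewrite -(cvg_lim (@Rhausdorff R) (@triple_product x)); apply: limr_ge.
  by apply/cvg_ex; exists (theta p x); exact: triple_product.
apply: nearW => N; apply: mulr_ge0; first exact/ltW/trunc_scale_gt0.
by apply: prodr_ge0 => m _; exact: theta_factor_ge0.
Qed.

End fixed_p.
End triple_product.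

(** * The quotient of theta functions *)

Section dnq.
Variable R : realType.
Implicit Types (p h x y u v a : R).
Local Open Scope classical_set_scope.

Lemma sqrt01 p : 0 < p < 1 -> 0 < Num.sqrt p < 1.
Proof.
move=> /andP[p0 p1]; rewrite sqrtr_gt0 p0 /= -[ltRHS](@sqrtr1 R).
by rewrite ltr_sqrt.
Qed.

Lemma sqr_sqrt01 p : 0 < p < 1 -> Num.sqrt p ^+ 2 = p.
Proof. by move=> /andP[/ltW p0 _]; rewrite sqr_sqrtr. Qed.

Lemma expr01 p n : 0 < p < 1 -> (0 < n)%N -> 0 < p ^+ n < 1.
Proof. by move=> /andP[p0 p1] n0; rewrite exprn_gt0// exprn_ilt1 ?(ltW p0)// -lt0n. Qed.

Lemma thetaDpipi p x : theta p (x + pi + pi) = theta p x.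
Proof. by rewrite -[RHS]theta2pi; congr theta; ring. Qed.

Lemma thetaBpi p x : theta p (x - pi) = theta p (x + pi).
Proof. by rewrite -theta2pi; congr theta; ring. Qed.

Lemma theta_half_pi h : 0 < h < 1 -> theta h (pi / 2) = theta (h ^+ 4) pi.
Proof.
move=> h01; have := theta_bisection (pi / 2) h01.
have -> : pi / 2 + pi = - (pi / 2) + 2 * pi :> R by field.
have -> : 2 * (pi / 2) = pi :> R by field.
by rewrite theta2pi thetaN; lra.
Qed.

(** The bilinear identity at [v = - pi / 2], where the two terms have the common
    factor [theta h (pi / 2)]. *)
Lemma theta_mul_shift p x : 0 < p < 1 ->
  theta p x * theta p (x + pi) = theta (p ^+ 2) (2 * x + pi) * theta (p ^+ 2) pi.
Proof.
move=> p01; have h01 := sqrt01 p01; have hp := sqr_sqrt01 p01.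
set h := Num.sqrt p in h01 hp.
have h4 : h ^+ 4 = p ^+ 2 by rewrite -hp -exprM.
have := theta_bilinear (x + pi / 2) (- (pi / 2)) h01; rewrite hp thetaN.
have -> : x + pi / 2 + - (pi / 2) = x by ring.
have -> : x + pi / 2 - - (pi / 2) = x + pi by field.
have -> : - (pi / 2) + pi = pi / 2 :> R by field.
rewrite -mulrDl theta_bisection// theta_half_pi// h4.
have -> : 2 * (x + pi / 2) = 2 * x + pi by field.
by lra.
Qed.

Lemma theta_sqr_sum p x : 0 < p < 1 ->
  theta p x ^+ 2 + theta p (x + pi) ^+ 2 =
  2 * theta (p ^+ 2) 0 * theta (p ^+ 2) (2 * x).
Proof.
move=> p01; have h01 := sqrt01 p01; have hp := sqr_sqrt01 p01.
set h := Num.sqrt p in h01 hp.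
have h4 : h ^+ 4 = p ^+ 2 by rewrite -hp -exprM.
have E1 := theta_bilinear x 0 h01; have E2 := theta_bilinear (x + pi) 0 h01.
have -> : 2 * theta (p ^+ 2) 0 * theta (p ^+ 2) (2 * x) =
    (theta h 0 + theta h (0 + pi)) * (theta h x + theta h (x + pi)) / 2.
  by rewrite !theta_bisection// h4 mulr0; field.
move: E1 E2; rewrite hp !addr0 !subr0 thetaDpipi.
by lra.
Qed.

(** [1 - 2 (1 / 4 + 1 / 16 + ...) = 1 / 3]. *)
Lemma theta_small p x : 0 < p <= 4^-1 -> 3^-1 <= theta p x.
Proof.
move=> /andP[p0 p4]; have p01 : 0 < p < 1 by rewrite p0/=; lra.
have bnd N : 3^-1 + 2 / 3 * 4^-1 ^+ N <= theta_sum p x N.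
  elim: N => [|N IHN]; first by rewrite theta_sum0 expr0; lra.
  rewrite theta_sumS.
  have t1 := theta_term_le x N.+1 p01.
  have t2 : p ^+ N.+1 <= 4^-1 ^+ N.+1.
    by rewrite lerXn2r ?nnegrE ?(ltW p0)//.
  have : - 4^-1 ^+ N.+1 <= theta_term p x N.+1.
    by move: (le_trans t1 t2); rewrite ler_norml => /andP[].
  by move: IHN; rewrite exprS; lra.
rewrite -(cvg_lim (@Rhausdorff R) (theta_cvg (x := x) p01)); apply: limr_ge.
  by apply/cvg_ex; exists (theta p x); exact: theta_cvg.
apply: nearW => N; apply: le_trans (bnd N).
by rewrite lerDl mulr_ge0// exprn_ge0.
Qed.

(** A zero of theta for the nome p would give, by duplication, a zero for
    [p ^ 2], then for [p ^ 4], and so on, but there is none for small nomes. *)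
Lemma theta_gt0 p x : 0 < p < 1 -> 0 < theta p x.
Proof.
move=> p01; rewrite lt_neqAle theta_ge0// andbT eq_sym.
have [n pn] : exists n, p ^+ (2 ^ n) <= 4^-1.
  have /andP[p0 p1] := p01.
  have c0 : p ^+ n @[n --> \oo] --> (0 : R) by apply: cvg_expr; rewrite ger0_norm// ltW.
  have [n _ Hn] := cvgr_lt (0 : R) c0 (4^-1 : R) ltac:(lra).
  exists n; apply/ltW/Hn => /=; exact/ltnW/ltn_expl.
elim: n p x p01 pn => [|n IHn] p x p01 pn.
  by rewrite gt_eqF//; apply: lt_le_trans (theta_small x _); rewrite ?expr1 in pn *; lra.
have p201 := sqr01 p01.
have pn2 : (p ^+ 2) ^+ (2 ^ n) <= 4^-1 by rewrite -exprM -expnS.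
have : theta p x * theta p (x + pi) != 0.
  by rewrite theta_mul_shift// mulf_neq0// IHn.
by rewrite mulf_eq0 negb_or => /andP[].
Qed.

(** Up to a constant factor, Jacobi's function dn with real variable x. *)
Definition dnq p x : R := theta p x / theta p (x + pi).

Definition dnq_max p : R := dnq p 0.

Lemma dnq_gt0 p x : 0 < p < 1 -> 0 < dnq p x.
Proof. by move=> p01; rewrite divr_gt0// theta_gt0. Qed.

Lemma dnqDpi p x : 0 < p < 1 -> dnq p (x + pi) = (dnq p x)^-1.
Proof.
move=> p01; rewrite /dnq invf_div; congr (_ / _).
by rewrite thetaDpipi.
Qed.

Lemma dnq_pi p : 0 < p < 1 -> dnq p pi = (dnq_max p)^-1.
Proof. by move=> p01; rewrite -dnqDpi// add0r. Qed.

(** By the bilinear identity, twice the difference of the cross products is the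
    square of [theta h w - theta h (w + pi)], with [w = (x + pi) / 2]. *)
Lemma dnq_le p x : 0 < p < 1 -> dnq p x <= dnq_max p.
Proof.
move=> p01; have h01 := sqrt01 p01; have hp := sqr_sqrt01 p01.
set h := Num.sqrt p in h01 hp.
rewrite /dnq_max /dnq add0r ler_pdivrMr ?theta_gt0// mulrAC.
rewrite ler_pdivlMr ?theta_gt0// mulrC.
pose w := (x + pi) / 2.
have := theta_bilinear w (- w) h01; have := theta_bilinear w (w - pi) h01.
have -> : w + (w - pi) = x by rewrite /w; field.
have -> : w - (w - pi) = pi by ring.
have -> : w - pi + pi = w by ring.
rewrite thetaBpi.
have -> : w + - w = 0 by ring.
have -> : w - - w = x + pi by rewrite /w; field.
have -> : theta h (- w + pi) = theta h (w + pi).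
  by rewrite -thetaBpi -thetaN; congr theta; ring.
rewrite thetaN hp => E1 E2.
have := sqr_ge0 (theta h w - theta h (w + pi)); rewrite sqrrB; move: E1 E2.
by rewrite !expr2; lra.
Qed.

Lemma dnq_ge p x : 0 < p < 1 -> (dnq_max p)^-1 <= dnq p x.
Proof.
move=> p01; rewrite -[leRHS]invrK -dnqDpi// lef_pV2 ?posrE ?dnq_gt0//.
exact: dnq_le.
Qed.

Lemma dnq_max_ge1 p : 0 < p < 1 -> 1 <= dnq_max p.
Proof.
move=> p01; have := dnq_ge 0 p01; rewrite -/(dnq_max p) => H.
have L0 : 0 < dnq_max p by exact: dnq_gt0.
by rewrite leNgt; apply/negP => L1; move: H; rewrite -div1r ler_pdivrMr//; nra.
Qed.

(** The descending Landen transformation of dn: the nome is squared. *)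
Lemma dnq_landen p x : 0 < p < 1 ->
  dnq p x + (dnq p x)^-1 = 2 * dnq_max (p ^+ 2) * dnq (p ^+ 2) (2 * x).
Proof.
move=> p01; have p201 := sqr01 p01.
have t0 := gt_eqF (theta_gt0 x p01); have t1 := gt_eqF (theta_gt0 (x + pi) p01).
have -> : dnq p x + (dnq p x)^-1 = (theta p x ^+ 2 + theta p (x + pi) ^+ 2) /
    (theta p x * theta p (x + pi)) by rewrite /dnq; field; rewrite t0 t1.
rewrite theta_sqr_sum// theta_mul_shift// /dnq_max /dnq add0r.
by field; rewrite !gt_eqF// theta_gt0.
Qed.

End dnq.

Section dnq_bounds.
Variable R : realType.
Implicit Types (p h x y u v a : R).
Local Open Scope classical_set_scope.

Let dbl p x : 0 < p < 1 -> theta_sum p x N.*2 @[N --> \oo] --> theta p x.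
Proof. by move=> p01; exact: cvg_comp _ _ cvg_double (theta_cvg (x := x) p01). Qed.

Let theta_sum_even p N :
  theta_sum p 0 N.+1.*2 - theta_sum p pi N.+1.*2 =
  theta_sum p 0 N.*2 - theta_sum p pi N.*2 + 4 * p ^+ (N.*2.+1 ^ 2) /\
  theta_sum p 0 N.+1.*2 + theta_sum p pi N.+1.*2 =
  theta_sum p 0 N.*2 + theta_sum p pi N.*2 + 4 * p ^+ (N.*2.+2 ^ 2).
Proof.
rewrite doubleS !theta_sumS.
have sg : (-1) ^+ N.*2 = 1 :> R by rewrite -signr_odd odd_double.
have t0 n : theta_term p 0 n = p ^+ (n ^ 2) by rewrite /theta_term mulr0 cos0 mulr1.
have tpi n : theta_term p pi n = (-1) ^+ n * p ^+ (n ^ 2).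
  by rewrite -[pi]add0r theta_termDpi t0.
rewrite !t0 !tpi [(-1) ^+ N.*2.+2]exprS [(-1) ^+ N.*2.+1]exprS sg.
by split; ring.
Qed.

(** The left side is the sum of the terms of odd index and the right side that of
    the terms of even index; the comparison is term by term, from
    [(2 j + 1) ^ 2 >= 4 j ^ 2 + 1]. *)
Lemma theta_odd_le p : 0 < p < 1 ->
  theta p 0 - theta p pi <= 2 * p * (theta p 0 + theta p pi).
Proof.
move=> p01; have /andP[p0 p1] := p01.
(* The term added on the left is the next one of odd index. *)
have bnd N : theta_sum p 0 N.*2 - theta_sum p pi N.*2 + 4 * p ^+ (N.*2.+1 ^ 2) <=
    2 * p * (theta_sum p 0 N.*2 + theta_sum p pi N.*2).
  elim: N => [|N IHN]; first by rewrite !theta_sum0 expr1; lra.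
  have [-> ->] := theta_sum_even p N; rewrite [leRHS]mulrDr lerD//.
  have : p ^+ (N.+1.*2.+1 ^ 2) <= p * p ^+ (N.*2.+2 ^ 2).
    by rewrite -exprS; apply: ler_wiXn2l; [exact: ltW|exact: ltW|rewrite doubleS; nia].
  have : 0 <= p * p ^+ (N.*2.+2 ^ 2) by rewrite mulr_ge0 ?exprn_ge0// ltW.
  by lra.
have cl : theta_sum p 0 N.*2 - theta_sum p pi N.*2 @[N --> \oo] -->
    theta p 0 - theta p pi by apply: cvgB; exact: dbl.
have cr : 2 * p * (theta_sum p 0 N.*2 + theta_sum p pi N.*2) @[N --> \oo] -->
    2 * p * (theta p 0 + theta p pi).
  by apply: cvgM; [exact: cvg_cst|apply: cvgD; exact: dbl].
apply: (ler_cvg_to cl cr); apply: nearW => N; apply: le_trans (bnd N).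
by rewrite lerDl mulr_ge0// exprn_ge0// ltW.
Qed.

Lemma theta_odd_ge p : 0 < p < 1 -> 4 * p <= theta p 0 - theta p pi.
Proof.
move=> p01; have /andP[p0 p1] := p01.
have bnd N : 4 * p <= theta_sum p 0 N.+1.*2 - theta_sum p pi N.+1.*2.
  elim: N => [|N IHN].
    by have [-> _] := theta_sum_even p 0; rewrite !theta_sum0 expr1 subrr add0r.
  have [-> _] := theta_sum_even p N.+1.
  by apply: le_trans IHN _; rewrite lerDl mulr_ge0// exprn_ge0// ltW.
have cl : theta_sum p 0 N.*2 - theta_sum p pi N.*2 @[N --> \oo] -->
    theta p 0 - theta p pi by apply: cvgB; exact: dbl.
rewrite -(cvg_lim (@Rhausdorff R) cl); apply: limr_ge.
  by apply/cvg_ex; exists (theta p 0 - theta p pi).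
by exists 1%N => // -[//|N] _; exact: bnd.
Qed.

Lemma theta0_le3 p : 0 < p <= 2^-1 -> theta p 0 <= 3.
Proof.
move=> /andP[p0 p2]; have p01 : 0 < p < 1 by lra.
have bnd N : theta_sum p 0 N <= 3 - 2 * 2^-1 ^+ N.
  elim: N => [|N IHN]; first by rewrite theta_sum0 expr0; lra.
  have t1 : theta_term p 0 N.+1 <= 2^-1 ^+ N.+1.
    apply: le_trans (ler_norm _) _; apply: le_trans (theta_term_le _ _ p01) _.
    by rewrite lerXn2r ?nnegrE ?(ltW p0).
  by rewrite theta_sumS; move: t1 IHN; rewrite exprS; lra.
rewrite -(cvg_lim (@Rhausdorff R) (theta_cvg (x := 0) p01)); apply: limr_le.
  by apply/cvg_ex; exists (theta p 0); exact: theta_cvg.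
apply: nearW => N; apply: le_trans (bnd N) _.
by rewrite gerBl mulr_ge0// exprn_ge0.
Qed.

(** The elliptic modulus of nome [p ^ 2]. *)
Definition modq p : R := (dnq_max p ^+ 2 - 1) / (dnq_max p ^+ 2 + 1).

Let dnq_maxE p : dnq_max p = theta p 0 / theta p pi.
Proof. by rewrite /dnq_max /dnq add0r. Qed.

Lemma dnq_max_gt1 p : 0 < p < 1 -> 1 < dnq_max p.
Proof.
move=> p01; have /andP[p0 p1] := p01.
by rewrite dnq_maxE ltr_pdivlMr ?theta_gt0// mul1r; have := theta_odd_ge p01; lra.
Qed.

Lemma modq01 p : 0 < p < 1 -> 0 < modq p < 1.
Proof.
move=> p01; have L1 := dnq_max_gt1 p01.
have L2 : 1 < dnq_max p ^+ 2 by rewrite exprn_egt1.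
by rewrite /modq divr_gt0 ?ltr_pdivrMr/=; lra.
Qed.

(** Only the order of magnitude matters: the modulus of the nome [p ^ 2] is
    equivalent to [4 p] for small p. *)
Lemma modq_ge p : 0 < p <= 2^-1 -> 2 / 3 * p <= modq p.
Proof.
move=> p2; have p01 : 0 < p < 1 by lra.
have ta := theta_gt0 0 p01; have tb := theta_gt0 pi p01.
have -> : modq p = (theta p 0 ^+ 2 - theta p pi ^+ 2) /
    (theta p 0 ^+ 2 + theta p pi ^+ 2).
  rewrite /modq dnq_maxE; field; rewrite !gt_eqF//.
  by rewrite addr_gt0// exprn_gt0.
have d := theta_odd_ge p01; have a3 := theta0_le3 p2.
move: (theta p 0) (theta p pi) ta tb d a3 => a b ta tb d a3.
have /andP[p0 _] := p01.
rewrite ler_pdivlMr; last by rewrite addr_gt0// exprn_gt0.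
have H1 : a ^+ 2 + b ^+ 2 <= (a + b) * 6 by nra.
have H2 : 2 / 3 * p * (a ^+ 2 + b ^+ 2) <= 2 / 3 * p * ((a + b) * 6).
  by rewrite ler_wpM2l//; lra.
by apply: le_trans H2 _; rewrite subr_sqr; nra.
Qed.

Lemma dnq_max_ratio_le p : 0 < p < 1 ->
  (dnq_max p - 1) / (dnq_max p + 1) <= 2 * p.
Proof.
move=> p01; have ta := theta_gt0 0 p01; have tb := theta_gt0 pi p01.
have -> : (dnq_max p - 1) / (dnq_max p + 1) =
    (theta p 0 - theta p pi) / (theta p 0 + theta p pi).
  by rewrite dnq_maxE; field; rewrite !gt_eqF// addr_gt0.
by rewrite ler_pdivrMr ?addr_gt0//; exact: theta_odd_le.
Qed.

(** The value at 0 of the Landen transformation of [dnq] relates the maxima for the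
    nomes p and [p ^ 2]. *)
Lemma landen_modq p : 0 < p < 1 -> landen (modq p) = modq (p ^+ 2).
Proof.
move=> p01; have p201 := sqr01 p01.
have L1 := dnq_max_gt1 p01; have M1 := dnq_max_gt1 p201.
have := dnq_landen 0 p01; rewrite mulr0 -/(dnq_max _) -/(dnq_max (p ^+ 2)).
rewrite /landen /modq.
move: (dnq_max p) (dnq_max (p ^+ 2)) L1 M1 => L M L1 M1 LM.
have -> : 1 - ((L ^+ 2 - 1) / (L ^+ 2 + 1)) ^+ 2 = (M ^- 2) ^+ 2.
  have -> : M ^- 2 = 2 / (L + L^-1) by rewrite LM; field; rewrite gt_eqF//; lra.
  have L2 : 0 < L ^+ 2 by rewrite exprn_gt0//; lra.
  by field; rewrite !gt_eqF//; lra.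
have M2 : 0 < M ^+ 2 by rewrite exprn_gt0//; lra.
rewrite sqrtr_sqr ger0_norm ?invr_ge0 ?(ltW M2)//.
by field; rewrite !gt_eqF//; lra.
Qed.

(** Products of theta at symmetric arguments span a space of dimension 2. *)
Lemma theta_pair p a : 0 < p < 1 -> {AB : R * R | forall x,
  theta p (x + a) * theta p (x - a) =
  AB.1 * theta p x ^+ 2 + AB.2 * theta p (x + pi) ^+ 2}.
Proof.
move=> p01; have h01 := sqrt01 p01; have hp := sqr_sqrt01 p01.
set h := Num.sqrt p in h01 hp.
pose X0 := theta h 0; pose X1 := theta h pi.
pose Y0 := theta h a; pose Y1 := theta h (a + pi).
have D0 : X0 ^+ 2 - X1 ^+ 2 != 0.
  have := theta_odd_ge h01; rewrite -/X0 -/X1 => d.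
  rewrite gt_eqF// subr_sqr mulr_gt0//.
    by case/andP: h01 => h0 _; lra.
  by rewrite addr_gt0// theta_gt0.
exists ((Y0 * X0 - Y1 * X1) / (X0 ^+ 2 - X1 ^+ 2),
        (Y1 * X0 - Y0 * X1) / (X0 ^+ 2 - X1 ^+ 2)) => x /=.
have E1 := theta_bilinear x a h01; have E2 := theta_bilinear x 0 h01.
have E3 := theta_bilinear (x + pi) 0 h01.
rewrite !addr0 !subr0 thetaDpipi hp -!expr2 add0r -/X0 -/X1 in E1 E2 E3.
rewrite -/Y0 -/Y1 in E1.
have -> : theta p (x + a) * theta p (x - a) =
   (theta h x * Y0 + theta h (x + pi) * Y1) / 2 by rewrite -E1; field.
have -> : theta p x ^+ 2 = (theta h x * X0 + theta h (x + pi) * X1) / 2.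
  by rewrite -E2; field.
have -> : theta p (x + pi) ^+ 2 = (theta h (x + pi) * X0 + theta h x * X1) / 2.
  by rewrite -E3; field.
by field.
Qed.

Lemma dnq_pair p a : 0 < p < 1 -> {AB : R * R | forall x,
  0 < AB.1 + AB.2 * dnq p x ^+ 2 /\
  dnq p (x + a) * dnq p (x - a) * (AB.1 + AB.2 * dnq p x ^+ 2) =
  AB.1 * dnq p x ^+ 2 + AB.2}.
Proof.
move=> p01; have [[A B] /= H] := theta_pair a p01; exists (A, B) => x /=.
have Ex := H x; have Ey := H (x + pi); rewrite thetaDpipi in Ey.
have t0 := theta_gt0 x p01; have t1 := theta_gt0 (x + pi) p01.
have t2 := theta_gt0 (x + pi + a) p01; have t3 := theta_gt0 (x + pi - a) p01.
have t12 : 0 < theta p (x + pi) ^+ 2 by rewrite exprn_gt0.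
have den : A + B * dnq p x ^+ 2 =
    theta p (x + pi + a) * theta p (x + pi - a) / theta p (x + pi) ^+ 2.
  by rewrite Ey /dnq; field; rewrite gt_eqF.
have num : A * dnq p x ^+ 2 + B =
    theta p (x + a) * theta p (x - a) / theta p (x + pi) ^+ 2.
  by rewrite Ex /dnq; field; rewrite gt_eqF.
split; first by rewrite den divr_gt0// mulr_gt0.
rewrite den num /dnq [x + a + pi]addrAC [x - a + pi]addrAC.
by field; rewrite !gt_eqF.
Qed.

End dnq_bounds.

(** * Powers of the nome *)

Section odd_product.
Variable R : realType.
Implicit Types (p s x y u v a : R).
Local Open Scope classical_set_scope.

Definition cis x : R[i] := cos x +i* sin x.

Lemma cisD x y : cis (x + y) = cis x * cis y.
Proof. by rewrite /cis cosD sinD; apply/eqP; rewrite eq_complex /= eqxx /= addrC. Qed.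

Lemma cis0 : cis 0 = 1.
Proof. by rewrite /cis cos0 sin0. Qed.

Lemma cisX n x : cis x ^+ n = cis (n%:R * x).
Proof.
elim: n => [|n IHn]; first by rewrite mul0r cis0 expr0.
by rewrite exprS IHn -cisD -nat1r mulrDl mul1r.
Qed.

Lemma cis_prim k : (0 < k)%N -> k.-primitive_root (cis (2 * pi / k%:R)).
Proof.
move=> k0; have kn0 : k%:R != 0 :> R by rewrite pnatr_eq0 -lt0n.
apply/andP; split=> //; apply/forallP => j; apply/eqP.
rewrite unity_rootE cisX.
have [->|jk] := eqVneq j.+1 k.
  have -> : k%:R * (2 * pi / k%:R) = 0 + pi + pi :> R by field.
  by rewrite /cis !cosDpi !sinDpi cos0 sin0 opprK !oppr0; apply/eqP.
apply/negbTE; apply/negP => /eqP [c1 _].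
pose th := j.+1%:R * (pi / k%:R) : R.
have th0 : 0 < sin th.
  apply: sin_gt0_pi; rewrite /th; apply/andP; split.
    by rewrite mulr_gt0 ?ltr0n// divr_gt0 ?pi_gt0// ltr0n.
  rewrite mulrA ltr_pdivrMr ?ltr0n// mulrC ltr_pM2l ?pi_gt0// ltr_nat.
  by rewrite ltn_neqAle jk ltn_ord.
have : cos (th + th) = 1 by rewrite -[RHS]c1; congr cos; rewrite /th; field.
rewrite cosD; have := cos2Dsin2 th; move: th0.
by move: (sin th) (cos th) => sn cs; nra.
Qed.

Lemma theta_factorE s x : (theta_factor s x)%:C = `|1 + s%:C * cis x| ^+ 2.
Proof.
rewrite normc_def /= -rmorphXn /=; congr _%:C.
rewrite sqr_sqrtr ?addr_ge0 ?sqr_ge0//.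
have := cos2Dsin2 x; rewrite /theta_factor => cs.
by rewrite !mul0r subr0 addr0 add0r; move: cs; nra.
Qed.

Lemma theta_factor_prod s x k : odd k ->
  theta_factor (s ^+ k) (k%:R * x) =
  \prod_(j < k) theta_factor s (x + j%:R * (2 * pi / k%:R)).
Proof.
move=> ok; have k0 : (0 < k)%N by case: k ok.
apply: complexI; rewrite theta_factorE rmorph_prod /=.
under eq_bigr do rewrite theta_factorE.
rewrite prodrXl -normr_prod; congr (`|_| ^+ 2).
rewrite rmorphXn /= -cisX -exprMn.
under eq_bigr do rewrite cisD mulrA.
have [->|u0] := eqVneq (s%:C * cis x) 0.
  rewrite expr0n; case: (k) k0 => // n _; rewrite addr0 big1// => j _.
  by rewrite mul0r addr0.
set u := _ * _ in u0 *.
have := congr1 (fun q => q.[- u^-1]) (factor_Xn_sub_1 (cis_prim k0)).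
rewrite /= hornerD hornerXn hornerN hornerC horner_prod big_mkord => E.
transitivity ((- u) ^+ k * ((- u^-1) ^+ k - 1)).
  rewrite mulrBr -exprMn mulrNN divff// expr1n mulr1 exprNn -signr_odd ok.
  by rewrite expr1; ring.
rewrite -E -[X in X ^+ k]mulr1 -[k in _ ^+ k]card_ord -prodr_const -big_split /=.
apply: eq_bigr => j _; rewrite hornerXsubC cisX mulr1.
by field.
Qed.

Lemma theta_prodE p x k N : odd k ->
  theta_prod (p ^+ k) (k%:R * x) N =
  \prod_(j < k) theta_prod p (x + j%:R * (2 * pi / k%:R)) N.
Proof.
move=> ok; rewrite exchange_big /=; apply: eq_bigr => m _.
by rewrite -exprM mulnC exprM theta_factor_prod.
Qed.

Lemma dnq_cvg p x : 0 < p < 1 ->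
  theta_prod p x N / theta_prod p (x + pi) N @[N --> \oo] --> dnq p x.
Proof.
move=> p01.
have -> : (fun N => theta_prod p x N / theta_prod p (x + pi) N) =
    (fun N => trunc_scale p N * theta_prod p x N /
       (trunc_scale p N * theta_prod p (x + pi) N)).
  apply/funext => N; have := trunc_scale_gt0 p01 N => c0.
  by rewrite invfM mulrACA divff ?gt_eqF// mul1r.
apply: cvgM; first exact: triple_product.
apply: cvgV; last exact: triple_product.
by rewrite gt_eqF// theta_gt0.
Qed.

Lemma theta_prodDpi p x k N :
  theta_prod p (x + k%:R * (2 * pi)) N = theta_prod p x N.
Proof. by apply: eq_bigr => m _; rewrite /theta_factor cosDnpi2. Qed.

(** Grouping the factors of the triple product along the k-th roots of unity,
    [\prod_j (1 + s w ^ j z) = 1 + s ^ k z ^ k] for odd k, replaces the nome by its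
    k-th power and the argument by its k-fold multiple. *)
Lemma dnq_odd_product p x k : 0 < p < 1 -> odd k ->
  dnq (p ^+ k) (k%:R * x) = \prod_(j < k) dnq p (x + j%:R * (2 * pi / k%:R)).
Proof.
move=> p01 ok; have k0 : (0 < k)%N by case: k ok.
have pk01 := expr01 p01 k0.
have cl := @dnq_cvg (p ^+ k) (k%:R * x) pk01.
have cr : \prod_(j < k) (theta_prod p (x + j%:R * (2 * pi / k%:R)) N /
   theta_prod p (x + j%:R * (2 * pi / k%:R) + pi) N) @[N --> \oo] -->
   \prod_(j < k) dnq p (x + j%:R * (2 * pi / k%:R)).
  by apply: (cvg_big (@mul_continuous R)) => j _; exact: dnq_cvg.
rewrite -(cvg_lim (@Rhausdorff R) cl) -(cvg_lim (@Rhausdorff R) cr).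
congr (lim (_ @ \oo)); apply/funext => N; rewrite big_split /= prodfV.
rewrite -theta_prodE//; congr (_ / _).
have -> : \prod_(j < k) theta_prod p (x + j%:R * (2 * pi / k%:R) + pi) N =
    \prod_(j < k) theta_prod p (x + pi + j%:R * (2 * pi / k%:R)) N.
  by apply: eq_bigr => j _; rewrite addrAC.
rewrite -theta_prodE//.
have [l kl] : exists l, k = l.*2.+1.
  by exists k./2; rewrite -[LHS]odd_double_half ok.
have -> : k%:R * (x + pi) = k%:R * x + pi + l%:R * (2 * pi).
  by rewrite kl -natr1 -mul2n natrM; ring.
by rewrite theta_prodDpi.
Qed.

Lemma dnq2pi p x : dnq p (x + 2 * pi) = dnq p x.
Proof. by rewrite /dnq theta2pi addrAC theta2pi. Qed.

Lemma dnq_odd_pairs p x l : 0 < p < 1 ->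
  dnq (p ^+ l.*2.+1) (l.*2.+1%:R * x) = dnq p x *
  \prod_(j < l) (dnq p (x + j.+1%:R * (2 * pi / l.*2.+1%:R)) *
                 dnq p (x - j.+1%:R * (2 * pi / l.*2.+1%:R))).
Proof.
move=> p01; rewrite dnq_odd_product//; last by rewrite /= odd_double.
set a := 2 * pi / _; rewrite big_ord_recl /= mul0r addr0; congr (_ * _).
rewrite [RHS]big_split /= -addnn big_split_ord /=; congr (_ * _).
rewrite (reindex_inj rev_ord_inj)/=; apply: eq_bigr => j _.
rewrite /bump leq0n add1n -[RHS]dnq2pi; congr dnq.
have lE : (l + (l - j.+1)).+1%:R = l.*2.+1%:R - j.+1%:R :> R.
  by rewrite -natrB; [congr _%:R|]; have := ltn_ord j; lia.
have : l.*2.+1%:R != 0 :> R by rewrite pnatr_eq0.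
by rewrite lE /a; move: (l.*2.+1%:R : R) => k k0; field.
Qed.

End odd_product.

(** * Zolotarev's rational functions *)

Section zolotarev.
Variable R : realType.
Implicit Types (p x y f a : R).
Local Open Scope classical_set_scope.

Lemma cos_lipschitz x y : `|cos x - cos y| <= `|x - y|.
Proof.
wlog xy : x y / x < y => [H|].
  have [/H //|/H|->] := ltgtP x y; first by rewrite distrC (distrC y).
  by rewrite !subrr.
have [c _ E] := @MVT R cos (fun x => - sin x) x y xy (fun c _ => is_derive_cos c)
  (continuous_subspaceT (@continuous_cos R)).
rewrite distrC E normrM normrN (distrC x); apply: ler_piMl => //.
exact: sin_max.
Qed.

Lemma theta_lipschitz p : 0 < p < 1 ->
  exists C, forall x y, `|theta p x - theta p y| <= C * `|x - y|.
Proof.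
move=> p01; have b01 := sqrt01 p01; have bp := sqr_sqrt01 p01.
have /andP[p0 p1] := p01.
set b := Num.sqrt p in b01 bp; pose K := (1 - b)^-1.
have /andP[b0 b1] := b01; have K0 : 0 < K by rewrite invr_gt0 subr_gt0.
exists (2 * (K * K)) => x y.
have bnd N : `|theta_sum p x N - theta_sum p y N| <= 2 * (K * K) * `|x - y|.
  have sub (u v : R) : 1 + 2 * u - (1 + 2 * v) = 2 * (u - v) by ring.
  rewrite /theta_sum sub -sumrB normrM ger0_norm// -!mulrA ler_wpM2l//.
  apply: le_trans (ler_norm_sum _ _ _) _; rewrite big_add1 /=.
  apply: (@le_trans _ _ (\sum_(0 <= n < N) K * b ^+ n * `|x - y|)).
    apply: ler_sum => n _; rewrite /theta_term -mulrBr normrM.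
    rewrite ger0_norm ?exprn_ge0 ?(ltW p0)//.
    apply: (@le_trans _ _ (p ^+ (n.+1 ^ 2) * (n.+1%:R * `|x - y|))).
      rewrite ler_wpM2l ?exprn_ge0 ?(ltW p0)//; apply: le_trans (cos_lipschitz _ _) _.
      by rewrite -mulrBr normrM ger0_norm.
    rewrite mulrA ler_wpM2r// mulrC.
    apply: (@le_trans _ _ (n.+1%:R * b ^+ n * b ^+ n)); last first.
      by rewrite ler_wpM2r ?exprn_ge0 ?(ltW b0)//; exact: natr_expr_le.
    rewrite -mulrA ler_wpM2l// -bp -exprM -exprD.
    by apply: ler_wiXn2l; [exact: ltW|exact: ltW|nia].
  rewrite -mulr_suml -mulr_sumr mulrA ler_wpM2r// ler_wpM2l ?(ltW K0)//.
  by rewrite big_mkord; exact: geometric_sum_le.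
have c : `|theta_sum p x N - theta_sum p y N| @[N --> \oo] --> `|theta p x - theta p y|.
  by apply: cvg_norm; apply: cvgB; exact: theta_cvg.
rewrite -(cvg_lim (@Rhausdorff R) c); apply: limr_le.
  by apply/cvg_ex; exists `|theta p x - theta p y|.
by apply: nearW => N; exact: bnd.
Qed.

Lemma theta_continuous p x : 0 < p < 1 -> {for x, continuous (theta p)}.
Proof.
move=> p01; have [C HC] := theta_lipschitz p01.
apply/cvgrPdist_le => e e0.
have C1 : 0 < `|C| + 1 by rewrite ltr_wpDl.
apply/nbhs_ballP; exists (e / (`|C| + 1)); first by rewrite /= divr_gt0.
move=> y; rewrite /ball /= ltr_pdivlMr// => /ltW xy; apply: le_trans (HC x y) _.
apply: le_trans xy; rewrite mulrC ler_wpM2l//.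
by have := ler_norm C; lra.
Qed.

Lemma dnq_continuous p x : 0 < p < 1 -> {for x, continuous (dnq p)}.
Proof.
move=> p01; apply: continuousM; first exact: theta_continuous.
apply: (@continuousV _ _ (fun x => theta p (x + pi))).
  by rewrite gt_eqF// theta_gt0.
apply: (@continuous_comp _ _ _ (fun x => x + pi) (theta p)).
  by apply: continuousD; [exact: cvg_id|exact: cst_continuous].
exact: theta_continuous.
Qed.

Lemma dnq_surj p f : 0 < p < 1 -> (dnq_max p)^-1 <= f <= dnq_max p ->
  exists x, dnq p x = f.
Proof.
move=> p01 /andP[f1 f2].
have cont : {within `[0, pi], continuous (dnq p)}.
  by apply: within_continuousP => t _; exact: dnq_continuous.
have L1 := dnq_max_ge1 p01.
have LV : (dnq_max p)^-1 <= dnq_max p by exact: le_trans f1 f2.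
have [|c _ Hc] := IVT (v := f) (ltW (pi_gt0 R)) cont; last by exists c.
by rewrite -/(dnq_max p) dnq_pi// min_r// max_l// f1.
Qed.

Lemma size_prod_le (I : Type) (r : seq I) (F : I -> {poly R}) d :
  (forall i, (size (F i) <= d.+1)%N) ->
  (size (\prod_(i <- r) F i)%R <= (size r * d).+1)%N.
Proof.
move=> HF; elim: r => [|i r IHr]; first by rewrite big_nil size_poly1.
rewrite big_cons; apply: leq_trans (size_polyMleq _ _) _.
by have := HF i; move: IHr; rewrite /= mulSn; lia.
Qed.

(** An odd rational function of degree k that approximates the sign: it takes
    [dnq p x] to [dnq (p ^ k) (k x)]. For odd k its zeros and poles come from the
    pairing of the factors at opposite angles; for even k it is composed with a
    Landen step. *)
Lemma dnq_transform p k : 0 < p < 1 -> (0 < k)%N ->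
  exists S T : {poly R}, [/\ (size S <= k.+1)%N, (size T <= k.+1)%N &
    forall x, let f := dnq p x in let g := dnq (p ^+ k) (k%:R * x) in
      [/\ T.[f] != 0, S.[f] = g * T.[f], T.[- f] != 0 & S.[- f] = - g * T.[- f]]].
Proof.
move=> p01; have [n] := ubnP k; elim: n k => // n IHn k kn k0.
have [ok|ek] := boolP (odd k).
  have [l kl] : exists l, k = l.*2.+1.
    by exists k./2; rewrite -[LHS]odd_double_half ok.
  pose a (j : nat) : R := j.+1%:R * (2 * pi / k%:R).
  pose AB j := sval (dnq_pair (a j) p01).
  pose U j : {poly R} := (AB j).1 *: 'X^2 + (AB j).2%:P.
  pose V j : {poly R} := (AB j).1%:P + (AB j).2 *: 'X^2.
  have sU j : (size (U j) <= 3)%N.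
    apply: leq_trans (size_polyD _ _) _; rewrite geq_max.
    by rewrite (leq_trans (size_scale_leq _ _)) ?size_polyXn// (leq_trans (size_polyC_leq1 _)).
  have sV j : (size (V j) <= 3)%N.
    apply: leq_trans (size_polyD _ _) _; rewrite geq_max.
    by rewrite (leq_trans (size_polyC_leq1 _))// (leq_trans (size_scale_leq _ _)) ?size_polyXn.
  have sP (F : nat -> {poly R}) : (forall j, (size (F j) <= 3)%N) ->
      (size (\prod_(j <- iota 0 l) F j)%R <= k)%N.
    by move=> /(size_prod_le (iota 0 l)); rewrite size_iota muln2 -kl.
  exists ('X * \prod_(j <- iota 0 l) U j), (\prod_(j <- iota 0 l) V j).
  split.
  - apply: leq_trans (size_polyMleq _ _) _; rewrite size_polyX.
    by have := sP U sU; lia.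
  - by apply: leq_trans (sP V sV) _.
  move=> x f g.
  have Uf (z : R) j : z ^+ 2 = f ^+ 2 ->
      [/\ (V j).[z] != 0 & (U j).[z] = dnq p (x + a j) * dnq p (x - a j) * (V j).[z]].
    move=> zf; have [H1 H2] := svalP (dnq_pair (a j) p01) x.
    rewrite /U /V !(hornerD, hornerZ, hornerXn, hornerC) zf -/(AB j) in H1 H2 *.
    by rewrite H2 gt_eqF.
  have UV (z : R) : z ^+ 2 = f ^+ 2 ->
      (\prod_(j <- iota 0 l) V j).[z] != 0 /\ f * (\prod_(j <- iota 0 l) U j).[z] =
      g * (\prod_(j <- iota 0 l) V j).[z].
    move=> zf; rewrite !horner_prod; split.
      by rewrite prodf_seq_neq0; apply/allP => j _; have [-> _] := Uf z j zf.
    under eq_bigr => j _ do have [_ ->] := Uf z j zf.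
    rewrite big_split /= mulrA; congr (_ * _).
    rewrite /g kl dnq_odd_pairs// -kl -/f; congr (_ * _).
    by rewrite -(big_mkord xpredT (fun j => dnq p (x + a j) * dnq p (x - a j)))
      /index_iota subn0.
  have [v1 u1] := UV f erefl; have [v2 u2] := UV (- f) (sqrrN f).
  by split=> //; rewrite hornerM hornerX ?u1// mulNr u2 mulNr.
have [j kj] : exists j, k = j.*2 by exists k./2; rewrite -[LHS]odd_double_half (negbTE ek).
have j0 : (0 < j)%N by move: k0; rewrite kj double_gt0.
have [S [T [sS sT H]]] := IHn j ltac:(lia) j0.
have pj01 := expr01 p01 j0; have pj2 : (p ^+ j) ^+ 2 = p ^+ k by rewrite -exprM muln2 -kj.
pose L := dnq_max (p ^+ k).
have L0 : 0 < L by apply: dnq_gt0; apply: expr01.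
exists (S * S + T * T), ((2 * L) *: (S * T)).
have szM (A B : {poly R}) : (size A <= j.+1)%N -> (size B <= j.+1)%N ->
    (size (A * B)%R <= k.+1)%N.
  by move=> sA sB; apply: leq_trans (size_polyMleq _ _) _; rewrite kj; lia.
split.
- by apply: leq_trans (size_polyD _ _) _; rewrite geq_max !szM.
- by apply: leq_trans (size_scale_leq _ _) _; exact: szM.
move=> x f g; have [t1 s1 t2 s2] := H x; rewrite -/f in t1 s1 t2 s2.
set g' := dnq (p ^+ j) _ in s1 s2.
have g0 : 0 < g' by exact: dnq_gt0.
have gE : g = (g' + g'^-1) / (2 * L).
  rewrite dnq_landen// pj2 -/L /g kj -mul2n natrM mulrA.
  by field; rewrite gt_eqF.
have gn0 : g' != 0 by rewrite gt_eqF.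
have Ln0 : 2 * L != 0 by rewrite gt_eqF// mulr_gt0.
rewrite !(hornerD, hornerZ, hornerM) s1 s2 gE.
split.
- by apply: mulf_neq0 => //; apply: mulf_neq0 => //; exact: mulf_neq0.
- by field; rewrite gn0 gt_eqF.
- apply: mulf_neq0 => //; apply: mulf_neq0 => //; apply: mulf_neq0 => //.
  by rewrite oppr_eq0.
- by field; rewrite gn0 gt_eqF.
Qed.

(** The quotient [P / Q] is at most [2 p ^ k] in absolute value on the interval
    [[1 / L, L]] and at least [1 / (2 p ^ k)] on its opposite, for [L = dnq_max p]:
    it is [(s - 1) / (s + 1)] for the sign approximation s. *)
Lemma zolotarev_ratio p k : 0 < p < 1 -> (0 < k)%N ->
  exists P Q : {poly R}, [/\ (size P <= k.+1)%N, (size Q <= k.+1)%N &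
    forall f, (dnq_max p)^-1 <= f <= dnq_max p ->
      [/\ Q.[f] != 0, `|P.[f]| <= 2 * p ^+ k * `|Q.[f]|,
          P.[- f] != 0 & `|Q.[- f]| <= 2 * p ^+ k * `|P.[- f]|]].
Proof.
move=> p01 k0; have [S [T [sS sT H]]] := dnq_transform p01 k0.
exists (S - T), (S + T); split.
- by apply: leq_trans (size_polyD _ _) _; rewrite size_polyN geq_max sS.
- by apply: leq_trans (size_polyD _ _) _; rewrite geq_max sS.
move=> f /(dnq_surj p01)[x xf]; have := H x; rewrite xf /=.
set g := dnq _ _ => -[t1 s1 t2 s2].
have pk01 := expr01 p01 k0.
have g0 : 0 < g by exact: dnq_gt0.
have rho : `|g - 1| <= 2 * p ^+ k * (g + 1).
  have L1 := dnq_max_gt1 pk01.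
  have gL := dnq_le (k%:R * x) pk01; have Lg := dnq_ge (k%:R * x) pk01.
  have := dnq_max_ratio_le pk01; rewrite -/g in gL Lg.
  move: (dnq_max _) L1 gL Lg => L L1 gL Lg.
  rewrite -(@ler_pM2r _ (g + 1)); last by lra.
  apply: le_trans; rewrite -ler_pdivrMr; last by lra.
  rewrite ler_pdivrMr; last by lra.
  rewrite mulrAC ler_pdivlMr; last by lra.
  have Lg1 : 1 <= g * L by rewrite -ler_pdivrMr ?div1r//; lra.
  by have [g1|g1] := leP 1 g;
    [rewrite ger0_norm ?subr_ge0//|rewrite ltr0_norm ?subr_lt0//]; lra.
have g1 : g + 1 != 0 by rewrite gt_eqF//; lra.
rewrite !(hornerD, hornerN) s1 s2.
have -> : g * T.[f] + T.[f] = (g + 1) * T.[f] by ring.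
have -> : g * T.[f] - T.[f] = (g - 1) * T.[f] by ring.
have -> : - g * T.[- f] - T.[- f] = - (g + 1) * T.[- f] by ring.
have -> : - g * T.[- f] + T.[- f] = - (g - 1) * T.[- f] by ring.
rewrite !mulf_neq0 ?oppr_eq0//; split=> //; rewrite !normrM ?normrN mulrA ler_wpM2r//;
  rewrite [`|g + 1|]ger0_norm//; lra.
Qed.

End zolotarev.

(** * The nome of a modulus *)

Section nome.
Variable R : realType.
Implicit Types (l p x y : R).

(** [landen x / x ^ 2 = 1 / (1 + sqrt (1 - x ^ 2)) ^ 2] increases with x. *)
Lemma landen_ratio x y : 0 < x -> x <= y -> y < 1 ->
  y ^+ 2 * landen x <= x ^+ 2 * landen y.
Proof.
move=> x0 xy y1; have x01 : 0 < x < 1 by rewrite x0; lra.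
have y01 : 0 < y < 1 by rewrite y1; lra.
rewrite !landenE// mulrCA; apply: ler_wpM2l; first exact: sqr_ge0.
apply: ler_wpM2l; first exact: sqr_ge0.
have /andP[cx0 _] := compl01 x01; have /andP[cy0 _] := compl01 y01.
rewrite lef_pV2 ?posrE ?exprn_gt0//; try lra.
rewrite ler_sqr ?nnegrE; try lra.
rewrite lerD2l; apply: ler_wsqrtr; rewrite lerD2l lerN2 ler_sqr ?nnegrE//; lra.
Qed.

Lemma iter_landen_ratio x y n : 0 < x -> x <= y -> y < 1 ->
  (y / x) ^+ (2 ^ n) * iter n (@landen R) x <= iter n (@landen R) y.
Proof.
move=> x0 xy y1; have x01 : 0 < x < 1 by rewrite x0; lra.
have y01 : 0 < y < 1 by rewrite y1; lra.
have r1 : 1 <= y / x by rewrite ler_pdivlMr ?mul1r.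
elim: n => [|n IHn]; first by rewrite expr1 /= divfK// gt_eqF.
have /andP[u0 u1] := iter_landen01 n x01; have /andP[v0 v1] := iter_landen01 n y01.
have r0 : 1 <= (y / x) ^+ (2 ^ n) by exact: exprn_ege1.
rewrite expnS mulnC exprM !iterS.
move: (iter n _ x) (iter n _ y) (_ ^+ (2 ^ n)) r0 u0 u1 v0 v1 IHn.
move=> u v r r0 u0 u1 v0 v1 ruv.
have uv : u <= v by apply: le_trans ruv; apply: ler_peMl; first exact: ltW.
have u2 : 0 < u ^+ 2 by rewrite exprn_gt0.
have lu : 0 < landen u by have := @landen01 R u; rewrite u0 u1 => /(_ isT)/andP[].
rewrite -(ler_pM2l u2); apply: le_trans (landen_ratio u0 uv v1).
rewrite mulrA ler_wpM2r ?(ltW lu)// mulrC -exprMn.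
by rewrite ler_sqr ?nnegrE//; [rewrite mulr_ge0//; lra|exact: ltW].
Qed.

Lemma bernoulli_ge (r : R) m : 1 <= r -> 1 + m%:R * (r - 1) <= r ^+ m.
Proof.
move=> r1; elim: m => [|m IHm]; first by rewrite mul0r addr0 expr0.
have : (1 + m%:R * (r - 1)) * r <= r ^+ m.+1.
  by rewrite exprSr ler_wpM2r//; lra.
apply: le_trans; rewrite -natr1.
have : 0 <= m%:R * (r - 1) * (r - 1) by rewrite !mulr_ge0//; lra.
by lra.
Qed.

(** If the modulus of the nome [exp (- mu l)] were smaller than l, the discrepancy
    would be squared at each Landen step, whereas both moduli behave like
    the same power of the nome up to a bounded factor. *)
Lemma modq_nome l : 0 < l < 1 -> l <= modq (expR (- grotzsch_mu l)).
Proof.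
move=> l01; have m0 := grotzsch_mu_gt0 l01; have /andP[l0 l1] := l01.
set p := expR _.
have p01 : 0 < p < 1 by rewrite expR_gt0 -expR0 ltr_expR oppr_lt0.
have /andP[p0 p1] := p01; have /andP[q0 q1] := modq01 p01.
rewrite leNgt; apply/negP => ql.
pose r := l / modq p; have r1 : 1 < r by rewrite ltr_pdivlMr ?mul1r.
have ex n : (0 < 2 ^ n)%N by rewrite expn_gt0.
have xn n : iter n (@landen R) (modq p) = modq (p ^+ (2 ^ n)).
  elim: n => [|n IHn]; first by rewrite expr1.
  by rewrite iterS IHn landen_modq ?expr01// -exprM -expnSr.
have yn n : iter n (@landen R) l <= 4 * p ^+ (2 ^ n).
  have y01 := iter_landen01 n l01; have /andP[y0 y1] := y01.
  have := grotzsch_mu_le y01; rewrite grotzsch_mu_iter// -ler_expR lnK; last first.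
    by rewrite posrE divr_gt0.
  rewrite ler_pdivlMr// mulrC -ler_pdivlMr ?expR_gt0// => /le_trans; apply.
  by rewrite -expRN /p -expRM_natl natrX mulrN.
have bnd n : p ^+ (2 ^ n) <= 2^-1 -> r ^+ (2 ^ n) <= 6.
  move=> pn; have pn0 : 0 < p ^+ (2 ^ n) by rewrite exprn_gt0.
  have H1 := iter_landen_ratio n q0 (ltW ql) l1; rewrite -/r xn in H1.
  have H2 : r ^+ (2 ^ n) * (2 / 3 * p ^+ (2 ^ n)) <= r ^+ (2 ^ n) * modq (p ^+ (2 ^ n)).
    rewrite ler_wpM2l//; first by rewrite exprn_ge0//; lra.
    by apply: modq_ge; rewrite pn0.
  have := le_trans H2 (le_trans H1 (yn n)).
  rewrite !mulrA ler_pM2r//; lra.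
have c0 : (p ^+ n @[n --> \oo] --> (0 : R))%classic.
  by apply: cvg_expr; rewrite ger0_norm// ltW.
have [n _ Hn] := cvgr_lt (0 : R) c0 (2^-1 : R) ltac:(lra).
have [N nN rN] : exists2 N, (n <= N)%N & 6 < N%:R * (r - 1).
  exists (maxn n (Num.truncn (6 / (r - 1))).+1); first exact: leq_maxl.
  rewrite -ltr_pdivrMr ?subr_gt0//; apply: lt_le_trans (truncnS_gt _) _.
  by rewrite ler_nat leq_maxr.
have N2 : (N <= 2 ^ N)%N by exact: ltnW (ltn_expl N (ltnSn 1)).
have pN : p ^+ (2 ^ N) <= 2^-1 by apply/ltW/Hn; exact: leq_trans nN N2.
have := bnd N pN; rewrite leNgt => /negP; apply.
apply: lt_le_trans (bernoulli_ge (2 ^ N)%N (ltW r1)).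
apply: lt_le_trans rN _; rewrite -[leLHS]add0r; apply: lerD; first exact: ler01.
by rewrite ler_wpM2r ?subr_ge0 ?(ltW r1)// ler_nat.
Qed.

End nome.

(** * Transfer to two disjoint intervals *)

Section moebius.
Variable R : realType.
Implicit Types (a b c d x L om : R).

Lemma cross_ratio_omega a b c d : a < b -> c < d -> b < c \/ d < a ->
  let g := abs_cross_ratio a b c d in
  1 < g /\ 1 - g^-1 = (b - a) * (d - c) / ((c - a) * (d - b)).
Proof.
move=> ab cd sep g.
have gE : g = (c - a) * (d - b) / ((c - b) * (d - a)) /\
    0 < (c - b) * (d - a) /\ 0 < (c - a) * (d - b).
  rewrite /g /abs_cross_ratio; case: sep => sep.
    by rewrite !ger0_norm ?subr_ge0 ?mulr_gt0 ?subr_gt0//; lra.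
  rewrite !ltr0_norm ?subr_lt0; try lra.
  rewrite -[X in _ / X]mulrNN -[X in X / _]mulrNN !opprK.
  by split=> //; rewrite -mulrNN -[X in _ /\ 0 < X]mulrNN !opprB !mulr_gt0 ?subr_gt0//; lra.
have [-> [d0 n0]] := gE.
have gap : (c - a) * (d - b) - (c - b) * (d - a) = (b - a) * (d - c) by ring.
have pos : 0 < (b - a) * (d - c) by rewrite mulr_gt0 ?subr_gt0.
split; first by rewrite ltr_pdivlMr// mul1r; lra.
rewrite invf_div; apply: (@mulIf _ ((c - a) * (d - b))); first by rewrite gt_eqF.
by rewrite mulrBl !divfK ?gt_eqF// mul1r gap.
Qed.

(** The Moebius map [x -> (x - a) / (kap (x - d))] sends a, b, c, d to
    0, om, 1 / om and infinity. *)
Lemma moebius_normalization a b c d : a < b -> c < d -> b < c \/ d < a ->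
  let om := Num.sqrt (1 - (abs_cross_ratio a b c d)^-1) in
  exists2 kap, kap != 0 &
    (forall x, a <= x <= b -> x != d /\ 0 <= (x - a) / (kap * (x - d)) <= om) /\
    (forall x, c <= x <= d -> x != a /\ 0 <= kap * (x - d) / (x - a) <= om).
Proof.
move=> ab cd sep om; have [_ omE] := cross_ratio_omega ab cd sep.
have sqrt_eq (z : R) : 0 <= z -> z ^+ 2 = (b - a) * (d - c) / ((c - a) * (d - b)) -> z = om.
  by move=> z0 zE; rewrite /om omE -zE sqrtr_sqr ger0_norm.
have ba : 0 < b - a by rewrite subr_gt0.
have dc : 0 < d - c by rewrite subr_gt0.
case: sep => sep.
- have ca : 0 < c - a by lra.
  have db : 0 < d - b by lra.
  pose r := (b - a) * (c - a) / ((d - b) * (d - c)).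
  have r0 : 0 < r by rewrite divr_gt0 ?mulr_gt0.
  pose s := Num.sqrt r; have s0 : 0 < s by rewrite sqrtr_gt0.
  have s2 : s ^+ 2 = r by rewrite sqr_sqrtr// ltW.
  have E1 : (b - a) / (s * (d - b)) = om.
    apply: sqrt_eq; first by rewrite divr_ge0 ?mulr_ge0// ltW.
    by rewrite expr_div_n exprMn s2 /r; field; rewrite !gt_eqF.
  have E2 : s * (d - c) / (c - a) = om.
    apply: sqrt_eq; first by rewrite divr_ge0 ?mulr_ge0// ltW.
    by rewrite expr_div_n exprMn s2 /r; field; rewrite !gt_eqF.
  exists (- s); [by rewrite oppr_eq0 gt_eqF|split=> x /andP[x1 x2]].
    have dx : 0 < d - x by lra.
    split; first by rewrite lt_eqF//; lra.
    have -> : - s * (x - d) = s * (d - x) by ring.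
    apply/andP; split; first by rewrite divr_ge0 ?mulr_ge0 ?(ltW s0) ?(ltW dx)//; lra.
    rewrite -E1; apply: ler_pM; rewrite ?invr_ge0 ?mulr_ge0 ?(ltW s0) ?(ltW dx)//; try lra.
    by rewrite lef_pV2 ?posrE ?mulr_gt0// ler_pM2l//; lra.
  have xa : 0 < x - a by lra.
  split; first by rewrite gt_eqF//; lra.
  have -> : - s * (x - d) = s * (d - x) by ring.
  have dx : 0 <= d - x by lra.
  apply/andP; split; first by rewrite divr_ge0 ?mulr_ge0 ?(ltW s0) ?(ltW xa).
  rewrite -E2; apply: ler_pM; rewrite ?invr_ge0 ?mulr_ge0 ?(ltW s0) ?(ltW xa)//.
    by rewrite ler_pM2l//; lra.
  by rewrite lef_pV2 ?posrE//; lra.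
- have ac : 0 < a - c by lra.
  have bd : 0 < b - d by lra.
  pose r := (b - a) * (a - c) / ((b - d) * (d - c)).
  have r0 : 0 < r by rewrite divr_gt0 ?mulr_gt0.
  pose s := Num.sqrt r; have s0 : 0 < s by rewrite sqrtr_gt0.
  have s2 : s ^+ 2 = r by rewrite sqr_sqrtr// ltW.
  have E0 : (c - a) * (d - b) = (a - c) * (b - d) by ring.
  have E1 : (b - a) / (s * (b - d)) = om.
    apply: sqrt_eq; first by rewrite divr_ge0 ?mulr_ge0// ltW.
    by rewrite E0 expr_div_n exprMn s2 /r; field; rewrite !gt_eqF.
  have E2 : s * (d - c) / (a - c) = om.
    apply: sqrt_eq; first by rewrite divr_ge0 ?mulr_ge0// ltW.
    by rewrite E0 expr_div_n exprMn s2 /r; field; rewrite !gt_eqF.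
  exists s; [by rewrite gt_eqF|split=> x /andP[x1 x2]].
    have xd : 0 < x - d by lra.
    split; first by rewrite gt_eqF//; lra.
    apply/andP; split; first by rewrite divr_ge0 ?mulr_ge0 ?(ltW s0) ?(ltW xd)//; lra.
    rewrite -E1 ler_pdivrMr ?mulr_gt0// mulrAC ler_pdivlMr ?mulr_gt0//.
    have -> : (x - a) * (s * (b - d)) = s * ((x - a) * (b - d)) by ring.
    have -> : (b - a) * (s * (x - d)) = s * ((b - a) * (x - d)) by ring.
    rewrite ler_pM2l// -subr_ge0.
    have -> : (b - a) * (x - d) - (x - a) * (b - d) = (b - x) * (a - d) by ring.
    by rewrite mulr_ge0//; lra.
  have ax : 0 < a - x by lra.
  split; first by rewrite lt_eqF//; lra.
  have -> : s * (x - d) / (x - a) = s * (d - x) / (a - x).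
    by rewrite -(opprB a x) -(opprB d x) mulrN invrN mulrNN.
  have dx : 0 <= d - x by lra.
  apply/andP; split; first by rewrite divr_ge0 ?mulr_ge0 ?(ltW s0) ?(ltW ax).
  rewrite -E2 ler_pdivrMr// mulrAC ler_pdivlMr// -!mulrA ler_pM2l// -subr_ge0.
  have -> : (d - c) * (a - x) - (d - x) * (a - c) = (x - c) * (a - d) by ring.
  by rewrite mulr_ge0//; lra.
Qed.

Lemma homogenization (P u v : {poly R}) k :
  (size P <= k.+1)%N -> (size u <= 2)%N -> (size v <= 2)%N ->
  exists2 H : {poly R}, (size H <= k.+1)%N &
    forall x, v.[x] != 0 -> H.[x] = v.[x] ^+ k * P.[u.[x] / v.[x]].
Proof.
move=> sP su sv.
exists (\sum_(i < k.+1) P`_i *: (u ^+ i * v ^+ (k - i))).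
  apply: leq_trans (size_sum _ _ _) _; apply/bigmax_leqP => i _.
  apply: leq_trans (size_scale_leq _ _) _.
  apply: leq_trans (size_polyMleq _ _) _.
  have su' : (size (u ^+ i) <= i.+1)%N.
    by apply: leq_trans (size_poly_exp_leq _ _) _; rewrite ltnS; move: su; nia.
  have sv' : (size (v ^+ (k - i)) <= (k - i).+1)%N.
    by apply: leq_trans (size_poly_exp_leq _ _) _; rewrite ltnS; move: sv; nia.
  by have := ltn_ord i; move: su' sv'; lia.
move=> x v0; rewrite horner_sum (horner_coef_wide _ sP) mulr_sumr.
apply: eq_bigr => i _; rewrite hornerZ hornerM !horner_exp expr_div_n.
have ik : (i <= k)%N by rewrite -ltnS.
have -> : v.[x] ^+ k = v.[x] ^+ (k - i) * v.[x] ^+ i by rewrite -exprD subnK.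
have := expf_neq0 i v0; move: (v.[x] ^+ i) => w w0.
by field.
Qed.

(** Zolotarev's third problem: a rational function of degree k that is small on
    [[a, b]] and large on [[c, d]]. *)
Lemma zolotarev_intervals a b c d p k : a < b -> c < d -> b < c \/ d < a ->
  0 < p < 1 -> (0 < k)%N ->
  Num.sqrt (1 - (abs_cross_ratio a b c d)^-1) <= modq p ->
  exists P Q : {poly R}, [/\ (size P <= k.+1)%N, (size Q <= k.+1)%N,
    forall x, a <= x <= b -> Q.[x] != 0 /\ `|P.[x]| <= 2 * p ^+ k * `|Q.[x]| &
    forall x, c <= x <= d -> P.[x] != 0 /\ `|Q.[x]| <= 2 * p ^+ k * `|P.[x]|].
Proof.
move=> ab cd sep p01 k0 omp.
have [kap kap0 [Hab Hcd]] := moebius_normalization ab cd sep.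
have [P [Q [sP sQ PQ]]] := zolotarev_ratio p01 k0.
have L1 := dnq_max_gt1 p01; have mE : modq p = (dnq_max p ^+ 2 - 1) / (dnq_max p ^+ 2 + 1) by [].
move: (dnq_max p) L1 mE PQ => L L1 mE PQ.
pose u : {poly R} := kap *: ('X - d%:P) + ('X - a%:P).
pose v : {poly R} := L *: (kap *: ('X - d%:P) - ('X - a%:P)).
have su : (size u <= 2)%N.
  apply: leq_trans (size_polyD _ _) _; rewrite geq_max size_XsubC andbT.
  by apply: leq_trans (size_scale_leq _ _) _; rewrite size_XsubC.
have sv : (size v <= 2)%N.
  apply: leq_trans (size_scale_leq _ _) _.
  apply: leq_trans (size_polyD _ _) _; rewrite size_polyN geq_max size_XsubC andbT.
  by apply: leq_trans (size_scale_leq _ _) _; rewrite size_XsubC.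
have uE x : u.[x] = kap * (x - d) + (x - a).
  by rewrite /u hornerD hornerZ !hornerXsubC.
have vE x : v.[x] = L * (kap * (x - d) - (x - a)).
  by rewrite /v hornerZ hornerD hornerN hornerZ !hornerXsubC.
have [P' sP' PE] := homogenization sP su sv.
have [Q' sQ' QE] := homogenization sQ su sv.
have L2 : 1 < L ^+ 2 by rewrite exprn_egt1.
have Ln0 : L != 0 by rewrite gt_eqF//; lra.
(* [h -> (1 + h) / (1 - h)] maps [0, om] into [1, L ^ 2]. *)
have cayley h : 0 <= h <= modq p ->
    1 - h != 0 /\ L^-1 <= (1 + h) / (L * (1 - h)) <= L.
  move=> /andP[h0 hm].
  have hL : h * (L ^+ 2 + 1) <= L ^+ 2 - 1 by rewrite -ler_pdivlMr -?mE//; lra.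
  have h1 : 0 < 1 - h.
    have : h < 1 by apply: le_lt_trans hm _; rewrite mE ltr_pdivrMr; lra.
    by lra.
  have d0 : 0 < L * (1 - h) by rewrite mulr_gt0//; lra.
  rewrite gt_eqF//; split=> //; apply/andP; split.
    by rewrite ler_pdivlMr// mulKf ?gt_eqF//; lra.
  by rewrite ler_pdivrMr// mulrA -expr2; lra.
exists P', Q'; split=> // x xI.
- have [xd /andP[h0 h1]] := Hab x xI.
  have [hn1 hL] := cayley _ (introT andP (conj h0 (le_trans h1 omp))).
  set h := _ / _ in h0 h1 hn1 hL.
  have kxd : kap * (x - d) != 0.
    by rewrite mulf_neq0// subr_eq0.
  have xa : x - a = h * (kap * (x - d)) by rewrite divfK.
  have vx : v.[x] = kap * (x - d) * (L * (1 - h)) by rewrite vE xa; ring.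
  have vn0 : v.[x] != 0.
    by rewrite vx; apply: mulf_neq0 => //; exact: mulf_neq0.
  have ux : u.[x] / v.[x] = (1 + h) / (L * (1 - h)).
    rewrite vx uE xa; clearbody h; move: (kap * (x - d)) kxd => w w0.
    by field; rewrite w0 hn1 Ln0.
  have [Q0 PQx _ _] := PQ _ hL.
  rewrite PE// QE// ux; split; first by rewrite mulf_neq0// expf_neq0.
  by rewrite !normrM mulrCA ler_wpM2l.
- have [xa /andP[h0 h1]] := Hcd x xI.
  have [hn1 hL] := cayley _ (introT andP (conj h0 (le_trans h1 omp))).
  set h := _ / _ in h0 h1 hn1 hL.
  have xa0 : x - a != 0 by rewrite subr_eq0.
  have kx : kap * (x - d) = h * (x - a) by rewrite divfK.
  have vx : v.[x] = - ((x - a) * (L * (1 - h))) by rewrite vE kx; ring.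
  have vn0 : v.[x] != 0.
    by rewrite vx oppr_eq0; apply: mulf_neq0 => //; exact: mulf_neq0.
  have ux : u.[x] / v.[x] = - ((1 + h) / (L * (1 - h))).
    rewrite vx uE kx; clearbody h; move: (x - a) xa0 => w w0.
    by field; rewrite w0 hn1 Ln0.
  have [_ _ P0 QPx] := PQ _ hL.
  rewrite PE// QE// ux; split; first by rewrite mulf_neq0// expf_neq0.
  by rewrite !normrM mulrCA ler_wpM2l.
Qed.

End moebius.

(** * The numerical rank of Cauchy matrices *)

Lemma grotzsch_mu_inv_sqrt_le (R : realType) (g : R) : 1 < g ->
  2 * grotzsch_mu (1 / Num.sqrt g) <= ln (16 * g).
Proof.
move=> g1; have s1 : 1 < Num.sqrt g by rewrite -[ltLHS](@sqrtr1 R) ltr_sqrt//; lra.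
have l01 : 0 < 1 / Num.sqrt g < 1.
  have s0 : 0 < Num.sqrt g by lra.
  by rewrite div1r invr_gt0 s0 /= invf_lt1.
have s2 : Num.sqrt g * Num.sqrt g = g by rewrite -expr2 sqr_sqrtr//; lra.
have := grotzsch_mu_le l01.
have -> : 4 / (1 / Num.sqrt g) = 4 * Num.sqrt g by rewrite div1r invrK.
have -> : 16 * g = (4 * Num.sqrt g) * (4 * Num.sqrt g) by rewrite -{1}s2; ring.
by rewrite [X in _ -> _ <= X]lnM ?posrE ?mulr_gt0//; lra.
Qed.

Theorem mainTheorem11 (R : realType) (m n : nat) (a b c d : R)
    (x : 'I_m -> R) (y : 'I_n -> R) (s : 'cV[R[i]]_m) (t : 'cV[R[i]]_n)
    (eps : R) :
  (1 <= n)%N -> (n <= m)%N ->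
  a < b -> c < d -> b < c \/ d < a ->
  (forall j, a <= x j <= b) -> (forall j k : 'I_m, (j < k)%N -> x j < x k) ->
  (forall j, c <= y j <= d) -> (forall j k : 'I_n, (j < k)%N -> y j < y k) ->
  0 < eps < 1 ->
  let C := cauchy_mx x y s t in
  let gamma := abs_cross_ratio a b c d in
  (eps_rank eps C)%:Z <=
    Num.ceil (2 * grotzsch_mu (1 / Num.sqrt gamma) * ln (4 / eps) / pi ^+ 2) /\
  Num.ceil (2 * grotzsch_mu (1 / Num.sqrt gamma) * ln (4 / eps) / pi ^+ 2) <=
    Num.ceil (ln (16 * gamma) * ln (4 / eps) / pi ^+ 2).
Proof.
move=> _ _ ab cd sep xI _ yI _ /andP[e0 e1] C gamma.
have [g1 _] := cross_ratio_omega ab cd sep; rewrite -/gamma in g1.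
have g0 : 0 < gamma by lra.
have pi2 : 0 < pi ^+ 2 :> R by rewrite exprn_gt0// pi_gt0.
have ln0 : 0 < ln (4 / eps) by rewrite ln_gt0// ltr_pdivlMr//; lra.
split; last first.
  apply: le_ceil; rewrite ler_wpM2r ?invr_ge0 ?(ltW pi2)//.
  by rewrite ler_wpM2r ?(ltW ln0)//; exact: grotzsch_mu_inv_sqrt_le.
set lam := 1 / Num.sqrt gamma; set A := _ / pi ^+ 2.
have sg : 0 < Num.sqrt gamma by rewrite sqrtr_gt0.
have l01 : 0 < lam < 1.
  rewrite /lam div1r invr_gt0 sg /= invf_lt1//.
  by rewrite -[ltLHS](@sqrtr1 R) ltr_sqrt.
have omE : Num.sqrt (1 - lam ^+ 2) = Num.sqrt (1 - gamma^-1).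
  by rewrite /lam div1r exprVn sqr_sqrtr// ltW.
have om01 := compl01 l01; have mumu := grotzsch_mu_compl l01.
have mu0 := grotzsch_mu_gt0 l01; have mo0 := grotzsch_mu_gt0 om01.
rewrite omE in om01 mumu mo0.
set om := Num.sqrt (1 - gamma^-1) in om01 mumu mo0.
(* om is the modulus complementary to lam. *)
pose p : R := expR (- grotzsch_mu om).
have p01 : 0 < p < 1 by rewrite expR_gt0 -expR0 ltr_expR oppr_lt0.
have A0 : 0 < A by rewrite /A divr_gt0// mulr_gt0// mulr_gt0.
have cA : 0 < Num.ceil A by rewrite -(ltr_int R); exact: lt_le_trans A0 (ceil_ge A).
have [k kE] : exists k : nat, k%:Z = Num.ceil A.
  by exists `|Num.ceil A|%N; rewrite gtz0_abs.
have k0 : (0 < k)%N by rewrite -ltz_nat kE.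
have Ak : A <= k%:R.
  by apply: le_trans (ceil_ge A) _; rewrite -kE -pmulrn.
rewrite -kE lez_nat; apply: eps_rank_le => //.
have [P [Q [sP sQ Hx Hy]]] :=
  zolotarev_intervals ab cd sep p01 k0 (modq_nome om01).
have xy j l : x j != y l.
  have /andP[x1 x2] := xI j; have /andP[y1 y2] := yI l.
  by case: sep => sep; [rewrite lt_eqF//; lra|rewrite gt_eqF//; lra].
have p0 : 0 < p by exact: expR_gt0.
have r0 : 0 <= 2 * p ^+ k by rewrite mulr_ge0// exprn_ge0// ltW.
have := sigma_cauchy_le s t xy sP sQ r0 (fun j => Hx _ (xI j)) (fun l => Hy _ (yI l)).
move=> /le_trans; apply; rewrite ler_wpM2r ?sigma1_ge0//.
have -> : (2 * p ^+ k) ^+ 2 = 4 * expR (- (2 * k%:R * grotzsch_mu om)).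
  have -> : - (2 * k%:R * grotzsch_mu om) = (k * 2)%:R * (- grotzsch_mu om).
    by rewrite natrM; ring.
  by rewrite expRM_natl -/p exprM; move: (p ^+ k) => w; ring.
have -> : eps = 4 * expR (- ln (4 / eps)).
  by rewrite expRN lnK ?posrE ?divr_gt0// invf_div; field.
rewrite ler_pM2l// ler_expR lerN2.
apply: (@le_trans _ _ (2 * A * grotzsch_mu om)).
  have -> : 2 * A * grotzsch_mu om =
      4 * (grotzsch_mu lam * grotzsch_mu om) * ln (4 / eps) / pi ^+ 2.
    by rewrite /A; ring.
  rewrite mumu le_eqVlt; apply/orP; left; apply/eqP.
  by move: (ln _) (pi ^+ 2 : R) pi2 => w q q0; field; rewrite gt_eqF.
by rewrite ler_wpM2r ?(ltW mo0)// ler_wpM2l.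
Qed.
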